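(* Let $\Gamma$ be a group and let $r:\Gamma\to{\rm Spin}(7)$ be an unacceptable group morphism. Then the image $r(\Gamma)$ is contained in a ${\rm Spin}(1,6)$-subgroup of ${\rm Spin}(7)$, or equivalently, the $\mathbb{R}[\Gamma]$-module $E$ contains a $\Gamma$-stable line.
   Context: For a compact group $G$ and an arbitrary group $\Gamma$, a group morphism $r:\Gamma\to G$ is called unacceptable if there is a group morphism $r':\Gamma\to G$ such that $r(\gamma)$ and $r'(\gamma)$ are conjugate in $G$ for all $\gamma\in\Gamma$, but $r'$ is not $G$-conjugate to $r$. A ${\rm Spin}(1,6)$-subgroup of ${\rm Spin}(7)$ is a subgroup obtained as the inverse image, under the canonical double cover $\pi:{\rm Spin}(7)\to{\rm SO}(7)$, of the stabilizer in ${\rm SO}(7)$ of a line in $\mathbb{R}^7$ (here ${\rm Spin}(7)$ and ${\rm SO}(7)$ are the compact groups). $E=\mathbb{R}^7$ denotes the standard representation of ${\rm Spin}(7)$ (via $\pi$), viewed as an $\mathbb{R}[\Gamma]$-module via $r$. *)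

(* Defs.v *)
From HB Require Import structures.
From mathcomp Require Import all_boot all_order all_algebra all_fingroup.
From mathcomp Require Import ring.
From mathcomp Require Import boolp classical_sets reals.

Set Implicit Arguments.
Unset Strict Implicit.
Unset Printing Implicit Defensive.

Import Order.TTheory GRing.Theory Num.Theory.

Local Open Scope ring_scope.

Section Unacceptable.
Local Open Scope group_scope.

(* [x ^ y] is the conjugate [y^-1 * x * y]. *)
Definition conjugate (G : groupType) (x y : G) : Prop :=
  exists z : G, y = x ^ z.

Definition conjugate_hom (Gamma G : groupType) (r r' : Gamma -> G) : Prop :=
  exists z : G, forall g : Gamma, r' g = r g ^ z.

Definition unacceptable (Gamma G : groupType)
    (r : {multiplicative Gamma -> G}) : Prop :=
  exists r' : {multiplicative Gamma -> G},
    (forall g : Gamma, conjugate (r g) (r' g)) /\ ~ conjugate_hom r r'.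

End Unacceptable.

Section SymDiff.
Variable n : nat.
Implicit Types A B C : {set 'I_n}.

Definition symd A B : {set 'I_n} := (A :\: B) :|: (B :\: A).

Lemma in_symd A B i : (i \in symd A B) = (i \in A) (+) (i \in B).
Proof. by rewrite !inE; case: (i \in A); case: (i \in B). Qed.

Lemma symdA : associative symd.
Proof. by move=> A B C; apply/setP=> i; rewrite !in_symd addbA. Qed.

Lemma symdC : commutative symd.
Proof. by move=> A B; apply/setP=> i; rewrite !in_symd addbC. Qed.

Lemma symd0 : right_id finset.set0 symd.
Proof. by move=> A; apply/setP=> i; rewrite !in_symd inE addbF. Qed.

Lemma sym0d : left_id finset.set0 symd.
Proof. by move=> A; rewrite symdC symd0. Qed.

Lemma symdd A : symd A A = finset.set0.
Proof. by apply/setP=> i; rewrite in_symd inE addbb. Qed.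

Lemma symdK A : involutive (symd A).
Proof. by move=> B; rewrite symdA symdd sym0d. Qed.

Lemma symdKr B : involutive (symd^~ B).
Proof. by move=> A; rewrite -symdA symdd symd0. Qed.

End SymDiff.

(* The Clifford algebra of the Euclidean space R^n, with v ^ 2 = |v|^2.  An
   element is the family of its coordinates in the basis e_A, A a subset of
   {0, ..., n-1}, where e_A is the increasing product of the e_i, i in A.  Since
   e_i ^ 2 = 1 and e_i e_j = - e_j e_i for i != j, one has
   e_A e_B = (-1)^k e_(A symd B) with k = #{(i, j) in A x B | j < i}. *)
Definition cliff (R : Type) (n : nat) : Type := {ffun {set 'I_n} -> R}.

Section Clifford.
Variables (R : comNzRingType) (n : nat).
Implicit Types (A B C : {set 'I_n}) (i j : 'I_n).

HB.instance Definition _ := GRing.Lmodule.copy (cliff R n)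
  {ffun {set 'I_n} -> R^o}.

Definition csign A B : R :=
  \prod_(p : 'I_n * 'I_n | (p.2 < p.1)%N) (-1) ^+ ((p.1 \in A) && (p.2 \in B)).

Lemma csignDl A B C : csign (symd A B) C = csign A C * csign B C.
Proof.
rewrite -big_split /=; apply: eq_bigr => p _; rewrite in_symd.
by case: (p.1 \in A); case: (p.1 \in B); case: (p.2 \in C);
  rewrite /= ?expr0 ?expr1 ?mulr1 ?mul1r ?mulrNN ?mulr1.
Qed.

Lemma csignDr A B C : csign A (symd B C) = csign A B * csign A C.
Proof.
rewrite -big_split /=; apply: eq_bigr => p _; rewrite in_symd.
by case: (p.1 \in A); case: (p.2 \in B); case: (p.2 \in C);
  rewrite /= ?expr0 ?expr1 ?mulr1 ?mul1r ?mulrNN ?mulr1.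
Qed.

Lemma csign0l A : csign finset.set0 A = 1.
Proof. by apply: big1 => p _; rewrite inE. Qed.

Lemma csign0r A : csign A finset.set0 = 1.
Proof. by apply: big1 => p _; rewrite inE andbF. Qed.

Lemma csign_sq A B : csign A B * csign A B = 1.
Proof. by rewrite -csignDl symdd csign0l. Qed.

Lemma csign_cocycle A B C :
  csign A B * csign (symd A B) C = csign A (symd B C) * csign B C.
Proof. by rewrite csignDl csignDr mulrA. Qed.

Definition cbase A : cliff R n := [ffun B => (B == A)%:R].

Definition cone : cliff R n := cbase finset.set0.

(* The coordinate at A collects the products e_B e_C with B symd C = A. *)
Definition cmul (x y : cliff R n) : cliff R n :=
  [ffun A => \sum_B csign B (symd B A) * (x B * y (symd B A))].

Lemma cmulA : associative cmul.
Proof.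
move=> x y z; apply/ffunP=> A; rewrite !ffunE.
under eq_bigr => C _ do rewrite ffunE.
under [RHS]eq_bigr => B _ do rewrite ffunE.
transitivity (\sum_B \sum_C csign B (symd B A) * csign C (symd C B) *
                (x C * y (symd C B) * z (symd B A))).
  rewrite exchange_big /=; apply: eq_bigr => C _.
  rewrite !mulr_sumr [RHS](reindex_inj (can_inj (symdK C))) /=.
  apply: eq_bigr => D _.
  have -> : symd (symd C D) A = symd D (symd C A).
    by rewrite symdA (symdC D).
  rewrite symdK.
  have H := csign_cocycle C D (symd D (symd C A)).
  rewrite symdK in H.
  rewrite [csign (symd C D) _ * _]mulrC H; ring.
apply: eq_bigr => B _; rewrite mulr_suml mulr_sumr.
by apply: eq_bigr => C _; ring.
Qed.

Lemma cmul1 : left_id cone cmul.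
Proof.
move=> x; apply/ffunP=> A; rewrite ffunE (bigD1 finset.set0) //= big1 => [|B nB].
  by rewrite ffunE eqxx sym0d csign0l !mul1r addr0.
by rewrite ffunE (negPf nB) mul0r mulr0.
Qed.

Lemma cmulx1 : right_id cone cmul.
Proof.
move=> x; apply/ffunP=> A; rewrite ffunE (bigD1 A) //= big1 => [|B nB].
  by rewrite ffunE symdd eqxx csign0r !mulr1 mul1r addr0.
rewrite ffunE; case: eqP => [e|_]; last by rewrite !mulr0.
by case/negP: nB; rewrite -(symd0 B) -e symdK.
Qed.

Lemma cmulDl : left_distributive cmul +%R.
Proof.
move=> x y z; apply/ffunP=> A; rewrite !ffunE -big_split /=.
by apply: eq_bigr => B _; rewrite ffunE mulrDl mulrDr.
Qed.

Lemma cmulDr : right_distributive cmul +%R.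
Proof.
move=> x y z; apply/ffunP=> A; rewrite !ffunE -big_split /=.
by apply: eq_bigr => B _; rewrite ffunE !mulrDr.
Qed.

Lemma cone_neq0 : cone != 0.
Proof.
apply/eqP=> /ffunP/(_ finset.set0); rewrite !ffunE eqxx => /eqP.
by rewrite oner_eq0.
Qed.

HB.instance Definition _ := GRing.Zmodule_isNzRing.Build (cliff R n)
  cmulA cmul1 cmulx1 cmulDl cmulDr cone_neq0.

Lemma cmulE (x y : cliff R n) A :
  (x * y) A = \sum_B csign B (symd B A) * (x B * y (symd B A)).
Proof. exact: ffunE. Qed.

Lemma cscaleE (a : R) (x : cliff R n) A : (a *: x) A = a * x A.
Proof. exact: ffunE. Qed.

Lemma cscaleAl (a : R) (x y : cliff R n) : a *: (x * y) = (a *: x) * y.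
Proof.
apply/ffunP=> A; rewrite cscaleE !cmulE mulr_sumr.
by apply: eq_bigr => B _; rewrite cscaleE; ring.
Qed.

HB.instance Definition _ :=
  GRing.Lmodule_isLalgebra.Build R (cliff R n) cscaleAl.

Lemma cscaleAr (a : R) (x y : cliff R n) : a *: (x * y) = x * (a *: y).
Proof.
apply/ffunP=> A; rewrite cscaleE !cmulE mulr_sumr.
by apply: eq_bigr => B _; rewrite cscaleE; ring.
Qed.

HB.instance Definition _ :=
  GRing.Lalgebra_isAlgebra.Build R (cliff R n) cscaleAr.

Lemma cbaseM A B : cbase A * cbase B = csign A B *: cbase (symd A B).
Proof.
apply/ffunP=> C; rewrite cscaleE cmulE (bigD1 A) //= big1 => [|D nD].
  rewrite !ffunE eqxx mul1r addr0 (can2_eq (symdK A) (symdK A)).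
  by case: eqP => [->|_]; rewrite ?symdK // !mulr0.
by rewrite ffunE (negPf nD) mul0r mulr0.
Qed.

(* Reversal, i.e. the anti-automorphism fixing the e_i: it multiplies e_A by
   (-1)^(#|A| (#|A| - 1) / 2) = csign A A. *)
Definition crev (x : cliff R n) : cliff R n := [ffun A => csign A A * x A].

Lemma crevK : involutive crev.
Proof. by move=> x; apply/ffunP=> A; rewrite !ffunE mulrA csign_sq mul1r. Qed.

Lemma crevM x y : crev (x * y) = crev y * crev x.
Proof.
apply/ffunP=> A; rewrite ffunE !cmulE mulr_sumr.
rewrite (reindex_inj (can_inj (@symdKr _ A))) /=; apply: eq_bigr => B _.
rewrite !ffunE (symdC (symd B A)) symdA (symdC A B) -(symdA B) symdd symd0.
have [C ->] : exists C, A = symd C B by exists (symd A B); rewrite symdKr.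
rewrite (symdC B) symdKr; have h := csign_sq C B; rewrite !csignDl !csignDr.
transitivity ((csign C B * csign C B) *
  (csign C C * csign B B * csign B C * (x C * y B))); first by ring.
by rewrite h; ring.
Qed.

Lemma crev1 : crev 1 = 1.
Proof.
apply/ffunP=> A; rewrite !ffunE; case: eqP => [->|_]; last by rewrite mulr0.
by rewrite csign0l mul1r.
Qed.

Definition cvec (v : 'cV[R]_n) : cliff R n :=
  \sum_(i < n) v i 0 *: cbase [set i]%SET.

Definition dotv (u v : 'cV[R]_n) : R := (u^T *m v) 0 0.

Lemma cvec_is_linear : linear cvec.
Proof.
move=> a u v; rewrite /cvec scaler_sumr -big_split /=.
by apply: eq_bigr => i _; rewrite !mxE scalerDl scalerA.
Qed.

HB.instance Definition _ :=
  GRing.isLinear.Build R 'cV[R]_n (cliff R n) _ cvec cvec_is_linear.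

Lemma cvecE v i : cvec v [set i]%SET = v i 0.
Proof.
rewrite /cvec sum_ffunE (bigD1 i) //= big1 => [|j nj].
  by rewrite cscaleE ffunE eqxx mulr1 addr0.
by rewrite cscaleE ffunE (inj_eq set1_inj) eq_sym (negPf nj) mulr0.
Qed.

Lemma cvec_inj : injective cvec.
Proof. by move=> u v e; apply/colP=> i; rewrite -!cvecE e. Qed.

Lemma csign_set1 i j : csign [set i]%SET [set j]%SET = (-1) ^+ (j < i)%N.
Proof.
case: (boolP (j < i)%N) => [ji|nji].
  rewrite /csign (bigD1 (i, j)) //= !inE !eqxx big1 ?mulr1 // => -[k l] /=.
  by rewrite !inE xpair_eqE => /andP[_ /negPf ->].
apply: big1 => -[k l] /= lk; rewrite !inE.
by case: eqP lk => // ->; case: eqP => // ->; rewrite (negPf nji).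
Qed.

Lemma crev_cvec v : crev (cvec v) = cvec v.
Proof.
apply/ffunP=> A; rewrite ffunE /cvec sum_ffunE mulr_sumr.
apply: eq_bigr => i _; rewrite cscaleE ffunE; case: eqP => [->|_].
  by rewrite csign_set1 ltnn expr0 mul1r.
by rewrite !mulr0.
Qed.

Lemma cbase_comm i j :
  cbase [set i]%SET * cbase [set j]%SET + cbase [set j]%SET * cbase [set i]%SET =
  (i == j)%:R *+ 2 *: 1.
Proof.
rewrite !cbaseM !csign_set1 (symdC [set j]%SET).
case: (ltngtP i j) => [ij|ij|/val_inj ->].
- by rewrite -val_eqE (ltn_eqF ij) /= expr0 expr1 mul0rn scale0r scaleN1r
    scale1r subrr.
- by rewrite -val_eqE (gtn_eqF ij) /= expr0 expr1 mul0rn scale0r scaleN1r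
    scale1r addNr.
by rewrite eqxx symdd !scale1r mulr2n scalerDl scale1r.
Qed.

Lemma cvec_comm u v :
  cvec u * cvec v + cvec v * cvec u = (dotv u v *+ 2) *: 1.
Proof.
rewrite /cvec mulr_suml [X in _ + X]mulr_sumr -big_split /= /dotv mxE.
rewrite -sumrMnl scaler_suml; apply: eq_bigr => i _.
rewrite mulr_sumr mulr_suml -big_split /= (bigD1 i) //= big1 => [|j nj].
  rewrite addr0 mxE -!scalerAl -!scalerAr !scalerA.
  rewrite (mulrC (v i 0)) -scalerDr cbase_comm eqxx scalerA.
  by rewrite -[in RHS]mulr_natr.
rewrite -!scalerAl -!scalerAr !scalerA (mulrC (v j 0)) -scalerDr cbase_comm.
by rewrite eq_sym (negPf nj) mul0rn scale0r scaler0.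
Qed.

End Clifford.

Section CliffordVec.
Variables (R : realType) (n : nat).
Implicit Types (u v : 'cV[R]_n).

Lemma cvec_sq u : cvec u * cvec u = dotv u u *: 1.
Proof.
have h := cvec_comm u u.
apply: (@scalerI _ _ (2 : R)); first by rewrite pnatr_eq0.
by rewrite !scaler_nat mulr2n h scalerMnl.
Qed.

Lemma cvec_sandwich u v : dotv u u = 1 ->
  cvec u * cvec v * cvec u = cvec ((dotv u v *+ 2) *: u - v).
Proof.
move=> u1; have h := cvec_comm u v.
have -> : cvec u * cvec v = (dotv u v *+ 2) *: 1 - cvec v * cvec u.
  by rewrite -h addrK.
by rewrite mulrBl -mulrA cvec_sq u1 scale1r mulr1 -scalerAl mul1r linearB linearZ.
Qed.

End CliffordVec.

Section SpecialOrthogonal.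
Variables (R : realType) (n : nat).

Record SO : Type := MkSO {
  so_mx :> 'M[R]_n;
  _ : (so_mx^T *m so_mx == 1%:M) && (\det so_mx == 1) }.

HB.instance Definition _ := [isSub for so_mx].
HB.instance Definition _ := [Choice of SO by <:].

Lemma so_tr_mul (A : SO) : A^T *m A = 1%:M.
Proof. by case/andP: (valP A) => /eqP. Qed.

Lemma so_mul_tr (A : SO) : A *m A^T = 1%:M.
Proof. by apply: mulmx1C; exact: so_tr_mul. Qed.

Lemma so_det (A : SO) : \det A = 1.
Proof. by case/andP: (valP A) => _ /eqP. Qed.

Lemma so_one_subproof :
  ((1%:M : 'M[R]_n)^T *m 1%:M == 1%:M) && (\det (1%:M : 'M[R]_n) == 1).
Proof. by rewrite trmx1 mulmx1 det1 !eqxx. Qed.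

Lemma so_mul_subproof (A B : SO) :
  ((A *m B)^T *m (A *m B) == 1%:M) && (\det (A *m B) == 1).
Proof.
rewrite trmx_mul -mulmxA (mulmxA _ _ B) so_tr_mul mul1mx so_tr_mul.
by rewrite det_mulmx !so_det mulr1 !eqxx.
Qed.

Lemma so_inv_subproof (A : SO) :
  ((A^T)^T *m A^T == 1%:M) && (\det A^T == 1).
Proof. by rewrite trmxK so_mul_tr det_tr so_det !eqxx. Qed.

Definition so_one := MkSO so_one_subproof.
Definition so_mul A B := MkSO (so_mul_subproof A B).
Definition so_inv A := MkSO (so_inv_subproof A).

Lemma so_mulA : associative so_mul.
Proof. by move=> A B C; apply: val_inj; rewrite /= mulmxA. Qed.
Lemma so_mul1 : left_id so_one so_mul.
Proof. by move=> A; apply: val_inj; rewrite /= mul1mx. Qed.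
Lemma so_mulx1 : right_id so_one so_mul.
Proof. by move=> A; apply: val_inj; rewrite /= mulmx1. Qed.
Lemma so_mulV : left_inverse so_one so_inv so_mul.
Proof. by move=> A; apply: val_inj; rewrite /= so_tr_mul. Qed.
Lemma so_mulxV : right_inverse so_one so_inv so_mul.
Proof. by move=> A; apply: val_inj; rewrite /= so_mul_tr. Qed.

HB.instance Definition _ :=
  isGroup.Build SO so_mulA so_mul1 so_mulx1 so_mulV so_mulxV.

End SpecialOrthogonal.

Section Spin.
Variables (R : realType) (n : nat).
Implicit Types (x y : cliff R n) (u v : 'cV[R]_n) (s : seq 'cV[R]_n).

Definition unit_vec : pred 'cV[R]_n := [pred u | dotv u u == 1].

Definition is_spin x : Prop :=
  exists2 s, ~~ odd (size s) && all unit_vec s & x = \prod_(u <- s) cvec u.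

Lemma is_spin1 : is_spin 1.
Proof. by exists [::] => //; rewrite big_nil. Qed.

Lemma is_spinM x y : is_spin x -> is_spin y -> is_spin (x * y).
Proof.
move=> [s /andP[es us] ->] [t /andP[et ut] ->]; exists (s ++ t).
  by rewrite size_cat oddD (negPf es) et all_cat us ut.
by rewrite big_cat.
Qed.

Lemma crev_prod s :
  crev (\prod_(u <- s) cvec u) = \prod_(u <- rev s) cvec u.
Proof.
elim: s => [|u s IH]; first by rewrite !big_nil crev1.
by rewrite big_cons crevM IH crev_cvec rev_cons -cats1 big_cat big_seq1.
Qed.

Lemma is_spin_crev x : is_spin x -> is_spin (crev x).
Proof.
move=> [s us ->]; exists (rev s); last exact: crev_prod.
by rewrite size_rev all_rev.
Qed.

Lemma is_spin_mul_crev x : is_spin x -> x * crev x = 1.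
Proof.
move=> [s /andP[_ us] ->]; elim: s us => [|u s IH] /=.
  by rewrite big_nil crev1 mulr1.
move=> /andP[/eqP u1 us]; rewrite big_cons crevM crev_cvec.
by rewrite -mulrA (mulrA _ _ (cvec u)) IH // mul1r cvec_sq u1 scale1r.
Qed.

Lemma is_spin_crev_mul x : is_spin x -> crev x * x = 1.
Proof. by move=> /is_spin_crev/is_spin_mul_crev; rewrite crevK. Qed.

Record spin : Type := MkSpin {
  spin_val :> cliff R n;
  _ : `[< is_spin spin_val >] }.

HB.instance Definition _ := [isSub for spin_val].
HB.instance Definition _ := [Choice of spin by <:].

Lemma spinP (x : spin) : is_spin x.
Proof. exact/asboolP/(valP x). Qed.

Definition spin_one := MkSpin (asboolT is_spin1).
Definition spin_mul (x y : spin) :=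
  MkSpin (asboolT (is_spinM (spinP x) (spinP y))).
Definition spin_inv (x : spin) := MkSpin (asboolT (is_spin_crev (spinP x))).

Lemma spin_mulA : associative spin_mul.
Proof. by move=> x y z; apply: val_inj; rewrite /= mulrA. Qed.
Lemma spin_mul1 : left_id spin_one spin_mul.
Proof. by move=> x; apply: val_inj; rewrite /= mul1r. Qed.
Lemma spin_mulx1 : right_id spin_one spin_mul.
Proof. by move=> x; apply: val_inj; rewrite /= mulr1. Qed.
Lemma spin_mulV : left_inverse spin_one spin_inv spin_mul.
Proof.
by move=> x; apply: val_inj; rewrite /= is_spin_crev_mul //; exact: spinP.
Qed.
Lemma spin_mulxV : right_inverse spin_one spin_inv spin_mul.
Proof.
by move=> x; apply: val_inj; rewrite /= is_spin_mul_crev //; exact: spinP.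
Qed.

HB.instance Definition _ :=
  isGroup.Build spin spin_mulA spin_mul1 spin_mulx1 spin_mulV spin_mulxV.

(* The matrix, on column vectors, of v |-> x v x^-1 (see [cvec_spin_mx]); the
   inverse of x in the spin group is its reversal. *)
Definition spin_mx x : 'M[R]_n :=
  \matrix_(i, j) (x * cvec (delta_mx j 0) * crev x) [set i]%SET.

Definition spin_reflection u : 'M[R]_n := (u *m u^T) *+ 2 - 1%:M.

Lemma spin_reflectionE u v :
  spin_reflection u *m v = (dotv u v *+ 2) *: u - v.
Proof.
rewrite mulmxBl mul1mx mulmxDl -mulmxA [u^T *m v]mx11_scalar -/(dotv u v).
by rewrite mul_mx_scalar mulr2n scalerDl.
Qed.

Lemma sandwich_prod s v : all unit_vec s ->
  \prod_(u <- s) cvec u * cvec v * crev (\prod_(u <- s) cvec u) =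
  cvec (foldr (fun u A => spin_reflection u *m A) 1%:M s *m v).
Proof.
elim: s v => [|u s IH] v /=; first by rewrite big_nil crev1 mulr1 mul1r mul1mx.
move=> /andP[/eqP u1 us]; rewrite big_cons crevM crev_cvec.
rewrite -!mulrA (mulrA (cvec v)) (mulrA (\prod_(_ <- _) _)) (mulrA _ (cvec v)).
by rewrite IH // mulrA cvec_sandwich // -spin_reflectionE mulmxA.
Qed.

Lemma spin_mx_prod s : all unit_vec s ->
  spin_mx (\prod_(u <- s) cvec u) =
  foldr (fun u A => spin_reflection u *m A) 1%:M s.
Proof.
move=> us; apply/matrixP=> i j; rewrite mxE sandwich_prod // cvecE.
by rewrite -colE mxE.
Qed.

Lemma cvec_spin_mx x v : is_spin x ->
  cvec (spin_mx x *m v) = x * cvec v * crev x.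
Proof.
by move=> [s /andP[_ us] ->]; rewrite spin_mx_prod // sandwich_prod.
Qed.

Lemma det_1BM p q (A : 'M[R]_(p, q)) (B : 'M[R]_(q, p)) :
  \det (1%:M - A *m B) = \det (1%:M - B *m A).
Proof.
have e : block_mx 1%:M 0 A 1%:M *m block_mx 1%:M B 0 (1%:M - A *m B) =
         block_mx (1%:M - B *m A) B 0 1%:M *m block_mx 1%:M 0 A 1%:M.
  rewrite !mulmx_block !mulmx1 !mul1mx !mulmx0 !mul0mx !addr0 !add0r.
  by rewrite subrK addrC subrK.
move/(congr1 determinant): e; rewrite !det_mulmx !det_ublock !det_lblock !det1.
by rewrite !mul1r !mulr1.
Qed.

Lemma det_spin_reflection u : dotv u u = 1 ->
  \det (spin_reflection u) = - (-1) ^+ n.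
Proof.
move=> u1; have -> : spin_reflection u = (-1) *: (1%:M - (u *+ 2) *m u^T).
  by rewrite scaleN1r opprB mulmxDl.
rewrite detZ det_1BM mulmxDr -/(dotv _ _) [u^T *m u]mx11_scalar -/(dotv u u) u1.
rewrite -mulr2n det_mx11 !mxE eqxx /= -mulr2n.
by have -> : 1 - 1 *+ 2 = -1 :> R; rewrite ?mulrN1 // mulr2n opprD addNKr.
Qed.

Lemma spin_reflection_orth u : dotv u u = 1 ->
  (spin_reflection u)^T *m spin_reflection u = 1%:M.
Proof.
move=> u1; have -> : (spin_reflection u)^T = spin_reflection u.
  by rewrite linearB /= linearMn /= trmx_mul trmxK trmx1.
rewrite {2}/spin_reflection mulmxBr mulmx1 mulmxDr mulmxA spin_reflectionE u1.
rewrite scalerDl scale1r addrK /spin_reflection -mulr2n.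
by rewrite opprB addrC subrK.
Qed.

Lemma spin_mx_SO x : is_spin x ->
  ((spin_mx x)^T *m spin_mx x == 1%:M) && (\det (spin_mx x) == 1).
Proof.
move=> [s /andP[es us] ->]; rewrite spin_mx_prod //.
have -> : \det (foldr (fun u A => spin_reflection u *m A) 1%:M s) =
          (- (-1) ^+ n) ^+ size s.
  elim: s us {es} => [|u s IH] /=; first by rewrite det1.
  by move=> /andP[/eqP u1 us]; rewrite det_mulmx det_spin_reflection // IH // exprS.
apply/andP; split; last first.
  rewrite -(odd_double_half (size s)) (negPf es) add0n -mul2n exprM sqrrN.
  by rewrite sqrr_sign expr1n.
elim: s us {es} => [|u s IH] /=; first by rewrite trmx1 mulmx1.
move=> /andP[/eqP u1 us]; rewrite trmx_mul -mulmxA (mulmxA _ (spin_reflection u)).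
by rewrite spin_reflection_orth // mul1mx IH.
Qed.

Definition spin_pi (x : spin) : SO R n := MkSO (spin_mx_SO (spinP x)).

Lemma spin_piE (x : spin) v :
  cvec (spin_pi x *m v) = spin_val x * cvec v * spin_val (x^-1)%g.
Proof. by apply: cvec_spin_mx; exact: spinP. Qed.

Lemma spin_pi_is_multiplicative : {morph spin_pi : x y / (x * y)%g}.
Proof.
move=> x y; apply: val_inj => /=; apply/matrixP=> i j.
have h (A : 'M[R]_n) : A i j = cvec (A *m delta_mx j 0) [set i]%SET.
  by rewrite cvecE -colE mxE.
have hx := spinP x; have hy := spinP y; have hxy := is_spinM hx hy.
by rewrite !h -mulmxA !cvec_spin_mx // crevM !mulrA.
Qed.

HB.instance Definition _ :=
  isMultiplicative.Build spin (SO R n) spin_pi spin_pi_is_multiplicative.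

End Spin.

Local Open Scope classical_set_scope.

Definition SO_stabilizer (R : realType) (n : nat) (L : {vspace 'cV[R]_n}) :
    set (SO R n) :=
  [set A | (linfun (mulmx (A : 'M[R]_n)) @: L)%VS = L].

Definition is_Spin16_subgroup (R : realType) (H : set (spin R 7)) : Prop :=
  exists2 L : {vspace 'cV[R]_7},
    (\dim L = 1)%N & H = @spin_pi R 7 @^-1` SO_stabilizer L.

(* The action of Gamma on E = R^7 through r and spin_pi. *)
Definition E_act (R : realType) (Gamma : groupType)
    (r : {multiplicative Gamma -> spin R 7}) (g : Gamma) (v : 'cV[R]_7) :
    'cV[R]_7 :=
  (spin_pi (r g) : 'M[R]_7) *m v.

Definition has_stable_line (R : realType) (Gamma : groupType)
    (r : {multiplicative Gamma -> spin R 7}) : Prop :=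
  exists2 L : {vspace 'cV[R]_7},
    (\dim L = 1)%N & forall (g : Gamma) v, v \in L -> E_act r g v \in L.

(* Main.v *)
From HB Require Import structures.
Require Import Defs.
From mathcomp Require Import all_boot all_order all_algebra all_fingroup.
From mathcomp Require Import spectral complex ring.
From mathcomp Require Import boolp classical_sets reals.

(** Why an unacceptable morphism r stabilises a line of E = R^7.

    Let r' be element-conjugate but not conjugate to r, and suppose that E
    has no stable line.  Through the double cover, r and r' act orthogonally
    on E with the same character, so the two actions are conjugate in O(7)
    ([exists_isometry]), hence in SO(7) because -1 has determinant -1, hence
    by an element of Spin(7) ([SO_lift], [conj_same_pi]).  The kernel of the
    cover being 1, -1 ([spin_kernel]), a conjugate of r' has the form chi r
    for a character chi with values 1 and -1, which is not trivial since r'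
    is not conjugate to r.  The contradiction will be an h in Spin(7) with r
    h = chi h r: it makes chi r, hence r', conjugate to r.

    To find h, let s be the action of r on the spinors S = R^8, where E
    appears as the space of skew matrices [octL v].  Call a matrix U on S
    twisted when s U = chi U s.  Because r and chi r are element-conjugate, S
    and S twisted by chi have the same character, which yields twisted
    isometries, also between suitable subspaces of S.  A twisted matrix is
    orthogonal to E, for its component in E would span a stable line
    ([twisted_orth_octL]); so a skew twisted matrix lies in the Lie algebra
    of Spin(7), and is called a bivector.

    Choose a twisted skew N such that e = - N^2 is an orthogonal projection
    of the largest possible rank, and put p = 1 - e.  There is a twisted
    isometry U of the image of p; its skew part would enlarge N, so U is
    symmetric and U^2 = p.  As U has trace 0, its eigenspaces for 1 and -1
    have a common dimension k, at most 4 ([twisted_product]).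

    - If k = 0, then N^2 = -1, and such a bivector is a product of two unit
      vectors ([bivector_decomposable]): h = N.
    - If k = 4, then U^2 = 1.  Restricting vectors to skew forms on a
      4-dimensional eigenspace of U maps the 7-dimensional E to a
      6-dimensional space, so some vector anticommutes with U
      ([exists_anticommuting]).  These vectors form a stable subspace, which
      is not a line and so contains orthonormal v, w; then U is w v times a
      bivector of square -1: h = U is a product of four unit vectors
      ([involution_decomposable]).
    - A plane of S determines a line of E, formed of the vectors that
      preserve it ([orth_proj_plane_line]).  If k is 1 or 3, the image of p
      or of e is a stable plane, which gives a stable line
      ([no_stable_plane]).
    - If k = 2, the group permutes the two eigenplanes of U, and they
      determine the same line, which is then stable ([no_swapped_planes]). *)

Set Implicit Arguments.
Unset Strict Implicit.
Unset Printing Implicit Defensive.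

Import Order.TTheory GRing.Theory Num.Theory.

Local Open Scope ring_scope.

(** * Orthogonal projections and symmetric matrices *)

Lemma mxtrace_mul_tr (F : realDomainType) (m n : nat) (A : 'M[F]_(m, n)) :
  \tr (A *m A^T) = \sum_i \sum_j A i j ^+ 2.
Proof.
by apply: eq_bigr => i _; rewrite mxE; apply: eq_bigr => j _; rewrite mxE.
Qed.

Lemma mxtrace_mul_tr_ge0 (F : realDomainType) (m n : nat) (A : 'M[F]_(m, n)) :
  0 <= \tr (A *m A^T).
Proof.
by rewrite mxtrace_mul_tr; do 2!apply: sumr_ge0 => ? _; exact: sqr_ge0.
Qed.

Lemma mxtrace_mul_tr_eq0 (F : realDomainType) (m n : nat) (A : 'M[F]_(m, n)) :
  \tr (A *m A^T) = 0 -> A = 0.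
Proof.
rewrite mxtrace_mul_tr => /eqP; rewrite psumr_eq0 => [/allP h|i _]; last first.
  by apply: sumr_ge0 => j _; exact: sqr_ge0.
apply/matrixP => i j; rewrite mxE; apply/eqP; rewrite -sqrf_eq0.
have := h i (mem_index_enum _); rewrite psumr_eq0 => [|k _];
  last exact: sqr_ge0.
by move=> /allP/(_ j (mem_index_enum _)).
Qed.

Lemma mul_mx_tr_eq0 (F : realDomainType) (m n : nat) (A : 'M[F]_(m, n)) :
  A *m A^T = 0 -> A = 0.
Proof. by move=> h; apply: mxtrace_mul_tr_eq0; rewrite h mxtrace0. Qed.

Lemma row_free_gram_unit (F : realFieldType) (m n : nat) (B : 'M[F]_(m, n)) :
  row_free B -> B *m B^T \in unitmx.
Proof.
move=> fB; rewrite -row_free_unit -kermx_eq0; apply/eqP/row_matrixP => i.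
rewrite row0; set x := row i _.
have xK : x *m (B *m B^T) = 0.
  by apply/sub_kermxP; exact: row_sub.
apply: (row_free_inj fB); rewrite mul0mx; apply: mul_mx_tr_eq0.
by rewrite trmx_mul !mulmxA -(mulmxA x) xK mul0mx.
Qed.

Lemma mxtrace_idem (F : fieldType) (n : nat) (E : 'M[F]_n) :
  E *m E = E -> \tr E = (\rank E)%:R.
Proof.
move=> EE; have key r (C : 'M[F]_(n, r)) (D : 'M[F]_(r, n)) :
    row_full C -> row_free D -> C *m D *m (C *m D) = C *m D -> D *m C = 1%:M.
  move=> /row_fullP[C' C'C] fD /(congr1 (mulmx C')).
  rewrite !mulmxA C'C !mul1mx => DCD.
  by apply: (row_free_inj fD); rewrite /= DCD mul1mx.
rewrite -{1}(mulmx_base E) mxtrace_mulC key ?mxtrace1 ?col_base_full //.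
  exact: row_base_free.
by rewrite !mulmx_base.
Qed.

(** The orthogonal projection onto the row space of B, when B is row free. *)
Definition row_proj (F : fieldType) (m n : nat) (B : 'M[F]_(m, n)) : 'M[F]_n :=
  B^T *m invmx (B *m B^T) *m B.

Section RowProj.
Variables (F : realFieldType) (m n : nat) (B : 'M[F]_(m, n)).
Hypothesis fB : row_free B.

Lemma row_proj_tr : (row_proj B)^T = row_proj B.
Proof.
by rewrite /row_proj !trmx_mul trmxK trmx_inv trmx_mul trmxK mulmxA.
Qed.

Lemma row_projK : B *m row_proj B = B.
Proof. by rewrite /row_proj !mulmxA mulmxV ?mul1mx // row_free_gram_unit. Qed.

Lemma row_proj_idem : row_proj B *m row_proj B = row_proj B.
Proof. by rewrite {1}/row_proj -mulmxA row_projK. Qed.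

Lemma row_proj_sub p (X : 'M[F]_(p, n)) : (X <= B)%MS -> X *m row_proj B = X.
Proof. by move=> /submxP[Y ->]; rewrite -mulmxA row_projK. Qed.

(** If the row space of B is stable under X, then X maps the image of the
    projection into itself; row vectors are acted upon from the right. *)
Lemma row_proj_stable (X : 'M[F]_n) : (B *m X <= B)%MS ->
  row_proj B *m X *m row_proj B = row_proj B *m X.
Proof.
move=> BX; have -> : row_proj B *m X = B^T *m invmx (B *m B^T) *m (B *m X).
  by rewrite /row_proj !mulmxA.
by rewrite -[LHS]mulmxA row_proj_sub.
Qed.

End RowProj.

(** Over R[i] the matrix is Hermitian, so the spectral theorem provides a
    nonzero eigenvalue, which is real; being an eigenvalue is a rank
    condition and descends to R. *)
Lemma sym_eigenvalue (R : rcfType) (n : nat) (A : 'M[R]_n) :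
  A^T = A -> A != 0 -> exists2 l, l != 0 & eigenvalue A l.
Proof.
move=> symA A0; pose f := real_complex R; pose B := map_mx f A.
have hB : B \is hermsymmx.
  apply: realsym_hermsym.
    apply/is_hermitianmxP; rewrite expr0 scale1r; apply/matrixP => i j.
    by rewrite !mxE /= -{1}symA mxE.
  by apply/mxOverP => i j; rewrite mxE; apply/complex_realP; exists (A i j).
have /orthomx_spectralP eB := hermitian_normalmx hB.
have B0 : B != 0 by rewrite map_mx_eq0.
have [i di] : exists i, spectral_diag B 0 i != 0.
  apply/existsP; apply: contraNT B0; rewrite negb_exists => /forallP d0.
  rewrite eB; have -> : diag_mx (spectral_diag B) = 0.
    apply/matrixP => i j; rewrite !mxE.
    by have := d0 i; rewrite negbK => /eqP ->; rewrite mul0rn.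
  by rewrite mulmx0 mul0mx.
have /mxOverP/(_ 0 i)/complex_realP[l el] := hermitian_spectral_diag_real hB.
exists l; first by apply: contraNneq di => l0; rewrite el l0.
rewrite -(eigenvalue_map f) -/B.
set P := spectralmx B in eB.
have uP : P \in unitmx := spectral_unit B.
apply/eigenvalueP; exists (row i P).
  have -> : row i P *m B = row i (P *m B) by rewrite row_mul.
  rewrite eB !mulmxA mulmxV // mul1mx row_mul row_diag_mx -scalemxAl -rowE.
  by rewrite el.
apply/negP => /eqP r0; have e0 : (delta_mx 0 i : 'rV[R[i]]_n) = 0.
  by rewrite -(mulmxK uP (delta_mx 0 i)) -rowE r0 mul0mx.
by have /matrixP/(_ 0 i)/eqP := e0; rewrite !mxE !eqxx oner_eq0.
Qed.

Definition orth_proj (R : nzRingType) (n : nat) (E : 'M[R]_n) : Prop :=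
  E^T = E /\ E *m E = E.

Lemma orth_proj_tr_eq0 (R : realFieldType) (n : nat) (E : 'M[R]_n) :
  orth_proj E -> \tr E = 0 -> E = 0.
Proof. by move=> [Et EE] E0; apply: mxtrace_mul_tr_eq0; rewrite Et EE. Qed.

Lemma orth_projB (R : nzRingType) (n : nat) (E F : 'M[R]_n) :
  orth_proj E -> orth_proj F -> E *m F = F -> F *m E = F -> orth_proj (E - F).
Proof.
move=> [Et EE] [Ft FF] EF FE; split; first by rewrite linearB /= Et Ft.
by rewrite mulmxBl !mulmxBr EE EF FE FF subrr subr0.
Qed.

Lemma orth_proj_half (R : realFieldType) (n : nat) (E U : 'M[R]_n) :
  orth_proj E -> U^T = U -> U *m U = E -> E *m U = U -> U *m E = U ->
  orth_proj (2%:R^-1 *: (E + U)).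
Proof.
move=> [Et EE] Ut UU EU UE; split; first by rewrite linearZ /= linearD /= Et Ut.
rewrite -scalemxAl -scalemxAr; congr (_ *: _).
rewrite mulmxDl !mulmxDr EE EU UE UU [U + E]addrC -mulr2n -scaler_nat scalerA.
by rewrite mulVf ?scale1r // pnatr_eq0.
Qed.

(** The eigenprojection behaves like a polynomial in A: a matrix that
    commutes with A preserves the eigenspace, and so does its transpose since
    A is symmetric, hence it commutes with the orthogonal projection. *)
Lemma spectral_projection (R : rcfType) (n : nat) (A : 'M[R]_n) :
  A^T = A -> A != 0 ->
  exists l E, [/\ l != 0, E != 0, orth_proj E, A *m E = l *: E
    & forall X, X *m A = A *m X -> X *m E = E *m X].
Proof.
move=> symA A0; have [l l0 evl] := sym_eigenvalue symA A0.
pose B := row_base (eigenspace A l).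
have fB : row_free B := row_base_free _.
have BA : B *m A = l *: B by apply/eigenspaceP; rewrite eq_row_base.
exists l, (row_proj B); split=> //.
- apply: contraNneq evl => E0; rewrite -mxrank_eq0.
  rewrite -(eq_row_base (eigenspace A l)) -/B mxrank_eq0.
  by rewrite -(row_projK fB) E0 mulmx0.
- by split; [exact: row_proj_tr | exact: row_proj_idem].
- rewrite /row_proj !mulmxA; have -> : A *m B^T = l *: B^T.
    by rewrite -[LHS]trmxK trmx_mul trmxK symA BA linearZ.
  by rewrite -!scalemxAl.
have key X : X *m A = A *m X ->
    row_proj B *m X *m row_proj B = row_proj B *m X.
  move=> XA; apply: (row_proj_stable fB); rewrite eq_row_base;
    apply/eigenspaceP.
  by rewrite -mulmxA XA mulmxA BA -scalemxAl.
move=> X XA; rewrite -(key X XA).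
have XtA : X^T *m A = A *m X^T by rewrite -{1}symA -trmx_mul -XA trmx_mul symA.
have := key _ XtA; move: (row_proj B) (row_proj_tr B) => E Et.
by move=> /(congr1 trmx); rewrite !trmx_mul trmxK !Et mulmxA.
Qed.

(** * Intertwiners of orthogonal representations *)

Section Intertwiner.
Variables (R : rcfType) (Gamma : groupType) (n : nat).

Definition orth_rep (rho : Gamma -> 'M[R]_n) : Prop :=
  (forall g h, rho (g * h)%g = rho g *m rho h) /\
  (forall g, (rho g)^T *m rho g = 1%:M).

Lemma orth_repMt rho g : orth_rep rho -> rho g *m (rho g)^T = 1%:M.
Proof. by move=> [_ rt]; apply: mulmx1C. Qed.

Lemma orth_rep1 rho : orth_rep rho -> rho 1%g = 1%:M.
Proof.
move=> [rM rt]; have := rt 1%g; rewrite -{2}(mulg1 1%g) rM mulmxA rt.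
by rewrite mul1mx.
Qed.

Lemma orth_repV rho g : orth_rep rho -> rho g^-1%g = (rho g)^T.
Proof.
move=> hr; have [rM rt] := hr.
by rewrite -[LHS]mul1mx -(rt g) -mulmxA -rM mulgV orth_rep1 // mulmx1.
Qed.

Definition intertwines (rho rho' : Gamma -> 'M[R]_n) (T : 'M[R]_n) : Prop :=
  forall g, rho' g *m T = T *m rho g.

Lemma intertwines_tr rho rho' T : orth_rep rho -> orth_rep rho' ->
  intertwines rho rho' T -> intertwines rho' rho T^T.
Proof.
move=> hr hr' hT g; have /(congr1 trmx) := hT g^-1%g.
by rewrite !trmx_mul !orth_repV // !trmxK => <-.
Qed.

Lemma intertwinesM rho rho' rho'' S T :
  intertwines rho' rho'' S -> intertwines rho rho' T ->
  intertwines rho rho'' (S *m T).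
Proof. by move=> hS hT g; rewrite mulmxA hS -!mulmxA hT. Qed.

Lemma intertwinesD rho rho' S T :
  intertwines rho rho' S -> intertwines rho rho' T ->
  intertwines rho rho' (S + T).
Proof. by move=> hS hT g; rewrite mulmxDr mulmxDl hS hT. Qed.

Lemma intertwinesZ rho rho' a T :
  intertwines rho rho' T -> intertwines rho rho' (a *: T).
Proof. by move=> hT g; rewrite -scalemxAr -scalemxAl hT. Qed.

Lemma intertwinesB rho rho' S T :
  intertwines rho rho' S -> intertwines rho rho' T ->
  intertwines rho rho' (S - T).
Proof.
by move=> hS hT; rewrite -scaleN1r; apply: intertwinesD => //;
  apply: intertwinesZ.
Qed.

Lemma mxvec_dot (A B : 'M[R]_n) : (mxvec A *m (mxvec B)^T) 0 0 = \tr (A *m B^T).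
Proof.
rewrite mxE (reindex _ (curry_mxvec_bij n n)) /=.
transitivity (\sum_(p : 'I_n * 'I_n) A p.1 p.2 * B p.1 p.2).
  by apply: eq_bigr => -[i j] _; rewrite !mxE !mxvecE.
rewrite -(pair_bigA _ (fun i j => A i j * B i j)) /=.
by apply: eq_bigr => i _; rewrite mxE; apply: eq_bigr => j _; rewrite mxE.
Qed.

(** Gamma may be infinite and carries no Haar measure; finitely many values
    of f that form a basis of the span of all values will replace averaging. *)
Lemma spanning_family (f : Gamma -> 'M[R]_n) :
  exists m (x : 'I_m -> Gamma),
    row_free (\matrix_i mxvec (f (x i))) /\
    forall g, (mxvec (f g) <= \matrix_i mxvec (f (x i)))%MS.
Proof.
pose ok m := `[< exists x : 'I_m -> Gamma, row_free (\matrix_i mxvec (f (x i)))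
  >].
have ok0 : exists m, ok m.
  exists 0%N; apply/asboolP; exists (fun i : 'I_0 => 1%g).
  by rewrite /row_free [\matrix__ _]flatmx0 mxrank0.
have okb m : ok m -> (m <= n * n)%N.
  by move=> /asboolP[x /eqP <-]; exact: rank_leq_col.
case: (ex_maxnP ok0 okb) => m /asboolP[x fx] mmax; exists m, x; split=> // g.
set F := \matrix_i _; apply: contraT => gF.
suff : ok (m + 1)%N by move=> /mmax; rewrite addn1 ltnn.
apply/asboolP; exists (fun i => if split i is inl j then x j else g).
have -> : \matrix_i mxvec (f (if split i is inl j then x j else g)) =
          col_mx F (mxvec (f g)).
  by apply/row_matrixP => i; rewrite !rowK; apply/rowP => k; rewrite !mxE;
     case: (split i) => j; rewrite ?mxE // ord1.
rewrite /row_free -addsmxE.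
have d : mxdirect (F + mxvec (f g)).
  apply/mxdirect_addsP/eqP; rewrite -submx0; apply/rV_subP => v.
  rewrite sub_capmx => /andP[vF /sub_rVP[a va]].
  have [a0|a0] := eqVneq a 0; first by rewrite va a0 scale0r sub0mx.
  case/negP: gF; rewrite -(scale1r (mxvec _)) -(mulVf a0) -scalerA -va.
  exact: scalemx_sub.
rewrite (mxdirectP d) /= (eqP fx) eqn_add2l rank_rV.
by apply/eqP; case: eqP => // g0; case/negP: gF; rewrite g0 sub0mx.
Qed.

Section Casimir.
Variables (rho rho' : Gamma -> 'M[R]_n) (P Q : 'M[R]_n).
Hypotheses (hr : orth_rep rho) (hr' : orth_rep rho').
Hypotheses (projP : orth_proj P) (projQ : orth_proj Q).
Hypotheses (rhoP : intertwines rho rho P) (rhoQ : intertwines rho' rho' Q).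
Hypothesis eq_tr : forall g, \tr (rho g *m P) = \tr (rho' g *m Q).

Let f g := rho g *m P.
Let f' g := rho' g *m Q.
Let t g := \tr (f g).

(** Scalar products of the matrices s g E depend on the character of the
    subrepresentation cut out by E only. *)
Lemma corner_dot (s : Gamma -> 'M[R]_n) (E : 'M[R]_n) :
  orth_rep s -> orth_proj E -> intertwines s s E -> forall g h,
  mxvec (s g *m E) *m (mxvec (s h *m E))^T = (\tr (s (h^-1 * g)%g *m E))%:M.
Proof.
move=> hs [Et EE] sE g h; rewrite [LHS]mx11_scalar mxvec_dot; congr (_%:M).
rewrite trmx_mul Et -mulmxA (mulmxA E) EE mulmxA mxtrace_mulC mulmxA.
by rewrite -orth_repV // -(proj1 hs).
Qed.

(** Two subrepresentations with the same character have a nonzero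
    intertwiner. By [corner_dot] the families f and f' have the same Gram
    matrices, so they satisfy the same linear relations.  With H the inverse
    Gram matrix of a basis f (x k) of the span of f, the Casimir type sum of
    the H k j f' (x k) y f (x j)^T intertwines rho and rho' for every matrix
    y, and the trace of this operator in y is the squared norm of P, which
    does not vanish. *)
Lemma exists_corner_intertwiner : P != 0 ->
  exists T, [/\ T != 0, intertwines rho rho' T, Q *m T = T & T *m P = T].
Proof.
move=> P0; have [m [x [fF sF]]] := spanning_family f.
pose F := \matrix_i mxvec (f (x i)); pose F' := \matrix_i mxvec (f' (x i)).
pose G := F *m F^T; pose H := invmx G.
have uG : G \in unitmx := row_free_gram_unit fF.
have dotf g h : mxvec (f g) *m (mxvec (f h))^T = (t (h^-1 * g)%g)%:M.
  exact: corner_dot.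
have dotf' g h : mxvec (f' g) *m (mxvec (f' h))^T = (t (h^-1 * g)%g)%:M.
  by rewrite /t /f eq_tr; exact: corner_dot.
have eG : F' *m F'^T = G.
  apply/matrixP => i j; have h (A : 'M[R]_(m, n * n)) :
      (A *m A^T) i j = (row i A *m (row j A)^T) 0 0.
    by rewrite !mxE; apply: eq_bigr => k _; rewrite !mxE.
  by rewrite /G !h !rowK dotf dotf'.
have tV g : t g^-1%g = t g.
  have [Pt _] := projP; rewrite /t /f orth_repV // -[RHS]mxtrace_tr trmx_mul Pt.
  by rewrite mxtrace_mulC.
have tC g h : t (g * h)%g = t (h * g)%g.
  by rewrite /t /f !(proj1 hr) -mulmxA rhoP mulmxA mxtrace_mulC mulmxA.
pose b g : 'rV[R]_m := \row_i t ((x i)^-1 * g)%g.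
have bE g : mxvec (f g) *m F^T = b g.
  apply/rowP => i; rewrite [RHS]mxE.
  transitivity ((mxvec (f g) *m (row i F)^T) 0 0).
    by rewrite !mxE; apply: eq_bigr => k _; rewrite !mxE.
  by rewrite rowK dotf mxE eqxx mulr1n.
have bE' g : mxvec (f' g) *m F'^T = b g.
  apply/rowP => i; rewrite [RHS]mxE.
  transitivity ((mxvec (f' g) *m (row i F')^T) 0 0).
    by rewrite !mxE; apply: eq_bigr => k _; rewrite !mxE.
  by rewrite rowK dotf' mxE eqxx mulr1n.
(* coordinates of f g in the chosen basis; f' obeys the same formula *)
have decf g : mxvec (f g) = b g *m H *m F.
  have /submxP[y ey] := sF g; rewrite -bE ey.
  by rewrite -(mulmxA y F) -/G mulmxK.
have Ht : H^T = H by rewrite /H trmx_inv /G trmx_mul trmxK.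
have normb g : (t 1%g)%:M = b g *m H *m (b g)^T.
  have := dotf g g; rewrite mulVg {1 2}decf => <-.
  by rewrite !trmx_mul Ht !mulmxA -(mulmxA (b g *m H)) -/G mulmxKV.
have decf' g : mxvec (f' g) = b g *m H *m F'.
  apply/eqP; rewrite -subr_eq0; apply/eqP; apply: mul_mx_tr_eq0.
  have e1 : b g *m H *m F' *m (mxvec (f' g))^T = b g *m H *m (b g)^T.
    by rewrite -mulmxA -{1}[F']trmxK -trmx_mul bE'.
  have e2 : mxvec (f' g) *m (b g *m H *m F')^T = b g *m H *m (b g)^T.
    by rewrite !trmx_mul Ht !mulmxA bE'.
  have e3 : b g *m H *m F' *m (b g *m H *m F')^T = b g *m H *m (b g)^T.
    by rewrite !trmx_mul Ht !mulmxA -(mulmxA (b g *m H)) eG mulmxKV.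
  rewrite linearB /= mulmxBr !mulmxBl e1 e2 e3 dotf' mulVg (normb g).
  by rewrite !subrr.
have combf g : f g = \sum_k (b g *m H) 0 k *: f (x k).
  apply: (can_inj mxvecK); rewrite decf mulmx_sum_row linear_sum.
  by apply: eq_bigr => k _; rewrite rowK linearZ.
have combf' g : f' g = \sum_k (b g *m H) 0 k *: f' (x k).
  apply: (can_inj mxvecK); rewrite decf' mulmx_sum_row linear_sum.
  by apply: eq_bigr => k _; rewrite rowK linearZ.
pose Psi (K : 'M_m) y := \sum_k \sum_j K k j *: (f' (x k) *m y *m (f (x j))^T).
pose M g : 'M_m := \matrix_(l, i) t ((x l)^-1 * g * x i)%g.
have coef' g i k : (b (g * x i)%g *m H) 0 k = (H *m M g) k i.
  rewrite !mxE; apply: eq_bigr => l _; rewrite !mxE mulgA mulrC; congr (_ * _).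
  by rewrite -{1}Ht mxE.
have coef g l k : (b (g^-1 * x l)%g *m H) 0 k = (M g *m H) l k.
  rewrite !mxE; apply: eq_bigr => i _; rewrite !mxE; congr (_ * _).
  by rewrite -tV !invMg !invgK.
(* both sides turn into multiplication of K by the same matrix H M g *)
have Psil g K y : rho' g *m Psi K y = Psi (H *m M g *m K) y.
  rewrite /Psi mulmx_sumr.
  transitivity (\sum_i \sum_j \sum_k
      (H *m M g) k i * K i j *: (f' (x k) *m y *m (f (x j))^T)).
    apply: eq_bigr => i _; rewrite mulmx_sumr; apply: eq_bigr => j _.
    rewrite -scalemxAr !mulmxA -(proj1 hr') -/(f' _) combf' !mulmx_suml.
    rewrite scaler_sumr; apply: eq_bigr => k _.
    by rewrite coef' -!scalemxAl scalerA mulrC.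
  rewrite exchange_big /=.
  under eq_bigr => j _ do rewrite exchange_big /=.
  rewrite exchange_big /=; apply: eq_bigr => k _; apply: eq_bigr => j _.
  by rewrite -scaler_suml mxE.
have Psir g K y : Psi K y *m rho g = Psi (K *m M g *m H) y.
  rewrite /Psi mulmx_suml; apply: eq_bigr => k _; rewrite mulmx_suml.
  transitivity (\sum_l \sum_j
      K k l * (M g *m H) l j *: (f' (x k) *m y *m (f (x j))^T)).
    apply: eq_bigr => l _; rewrite -scalemxAl -mulmxA.
    have -> : (f (x l))^T *m rho g = (f (g^-1 * x l)%g)^T.
      by rewrite /f (proj1 hr) orth_repV // -(mulmxA _ _ P) [in RHS]trmx_mul
        trmxK.
    rewrite combf linear_sum /= mulmx_sumr scaler_sumr.
    by apply: eq_bigr => j _; rewrite linearZ /= -scalemxAr scalerA coef.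
  rewrite exchange_big /=; apply: eq_bigr => j _.
  by rewrite -scaler_suml -(mulmxA K) [in RHS]mxE.
have [[y Ty]|noT] := pselect (exists y, Psi H y != 0); last first.
  have {}noT y : Psi H y = 0.
    by apply/eqP; apply: contraPT noT => yT; apply; exists y.
  case/negP: P0; apply/eqP/(orth_proj_tr_eq0 projP).
  have -> : \tr P = t 1%g by rewrite /t /f orth_rep1 // mul1mx.
  have := normb 1%g => /matrixP/(_ 0 0); rewrite mxE eqxx mulr1n => ->.
  (* the trace of y |-> Psi H y, computed on the basis of elementary matrices *)
  transitivity (\sum_a \sum_c Psi H (delta_mx a c) a c); last first.
    by apply: big1 => a _; apply: big1 => c _; rewrite noT mxE.
  have entry (A B : 'M[R]_n) a c :
      (A *m delta_mx a c *m B^T) a c = A a a * B c c.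
    rewrite -(mul_delta_mx (0 : 'I_1)) mulmxA -mulmxA -colE -rowE mxE big_ord1.
    by rewrite !mxE.
  transitivity (\sum_k \sum_j H k j * (t (x k) * t (x j))).
    rewrite mxE; transitivity (\sum_j \sum_k H k j * (t (x k) * t (x j))).
      apply: eq_bigr => j _; rewrite !mxE mulr_suml; apply: eq_bigr => k _.
      by rewrite [b 1%g 0 k]mxE !mulg1 !tV; ring.
    exact: exchange_big.
  have tE' k : t (x k) = \sum_a f' (x k) a a by rewrite /t /f eq_tr.
  rewrite /Psi; symmetry.
  under eq_bigr => a _ do under eq_bigr => c _ do
    (rewrite summxE; under eq_bigr => k _ do
      (rewrite summxE; under eq_bigr => j _ do rewrite mxE entry)).
  under eq_bigr => a _ do rewrite exchange_big /=.
  rewrite exchange_big /=; apply: eq_bigr => k _.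
  under eq_bigr => a _ do rewrite exchange_big /=.
  rewrite exchange_big /=; apply: eq_bigr => j _.
  rewrite tE' mulr_suml mulr_sumr; apply: eq_bigr => a _.
  by rewrite [t (x j)]/mxtrace !mulr_sumr; apply: eq_bigr => c _.
have Qf' g : Q *m f' g = f' g.
  by rewrite /f' rhoQ mulmxA (proj2 projQ).
have fP g : (f g)^T *m P = (f g)^T.
  by rewrite /f rhoP trmx_mul (proj1 projP) -mulmxA (proj2 projP).
exists (Psi H y); split=> //.
- by move=> g; rewrite Psil Psir.
- rewrite /Psi mulmx_sumr; apply: eq_bigr => k _; rewrite mulmx_sumr.
  by apply: eq_bigr => j _; rewrite -scalemxAr 2!(mulmxA Q) Qf'.
rewrite /Psi mulmx_suml; apply: eq_bigr => k _; rewrite mulmx_suml.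
by apply: eq_bigr => j _; rewrite -scalemxAl -(mulmxA _ _ P) fP.
Qed.

End Casimir.

Lemma partial_isometry_tr (U : 'M[R]_n) :
  U *m U^T *m U = U -> orth_proj (U^T *m U) /\ orth_proj (U *m U^T).
Proof.
move=> UU; split; split; rewrite ?trmx_mul ?trmxK //.
  by rewrite -mulmxA (mulmxA U) UU.
by rewrite mulmxA UU.
Qed.

Section Isometry.
Variables (rho rho' : Gamma -> 'M[R]_n) (P Q : 'M[R]_n).
Hypotheses (hr : orth_rep rho) (hr' : orth_rep rho').
Hypotheses (projP : orth_proj P) (projQ : orth_proj Q).
Hypotheses (rhoP : intertwines rho rho P) (rhoQ : intertwines rho' rho' Q).
Hypothesis eq_tr : forall g, \tr (rho g *m P) = \tr (rho' g *m Q).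

Let good U := [/\ intertwines rho rho' U, Q *m U = U, U *m P = U
                & U *m U^T *m U = U].

(** If U does not exhaust P, the complements of its initial and final spaces
    still have equal characters, so a nonzero intertwiner T joins them; on an
    eigenspace of T^T T it is a multiple of an isometry, which extends U. *)
Lemma extend_partial_isometry U : good U -> U^T *m U != P ->
  exists2 V, good V & \tr (U^T *m U) < \tr (V^T *m V).
Proof.
move=> [hU QU UP UUU] UtUP.
have [[_ UtU] [_ UUt]] := partial_isometry_tr UUU.
have [[Pt PP] [Qt QQ]] := (projP, projQ).
have hUt := intertwines_tr hr hr' hU.
have PUt : P *m U^T = U^T by rewrite -{1}Pt -trmx_mul UP.
have UtQ : U^T *m Q = U^T by rewrite -{1}Qt -trmx_mul QU.
pose P1 := P - U^T *m U; pose Q1 := Q - U *m U^T.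
have UP1 : U *m P1 = 0 by rewrite mulmxBr UP mulmxA UUU subrr.
have UtQ1 : U^T *m Q1 = 0.
  rewrite mulmxBr UtQ; have -> : U^T *m (U *m U^T) = U^T.
    by rewrite -[in RHS]UUU !trmx_mul trmxK.
  by rewrite subrr.
have pP1 : orth_proj P1.
  apply: orth_projB => //; first by have [] := partial_isometry_tr UUU.
    by rewrite mulmxA PUt.
  by rewrite -mulmxA UP.
have pQ1 : orth_proj Q1.
  apply: orth_projB => //; first by have [] := partial_isometry_tr UUU.
    by rewrite mulmxA QU.
  by rewrite -mulmxA UtQ.
have rP1 : intertwines rho rho P1.
  by apply: intertwinesB => //; apply: intertwinesM hUt hU.
have rQ1 : intertwines rho' rho' Q1.
  by apply: intertwinesB => //; apply: intertwinesM hU hUt.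
have eq1 g : \tr (rho g *m P1) = \tr (rho' g *m Q1).
  rewrite !mulmxBr !linearB /= eq_tr; congr (_ - _).
  by rewrite [in RHS]mulmxA hU -[in RHS]mulmxA [in RHS]mxtrace_mulC !mulmxA.
have P10 : P1 != 0 by rewrite subr_eq0 eq_sym.
have [T [T0 hT QT TP]] := exists_corner_intertwiner hr hr' pP1 pQ1 rP1 rQ1 eq1
  P10.
have A0 : T^T *m T != 0.
  apply: contraNneq T0 => A0; apply/eqP/trmx_inj; rewrite trmx0.
  by apply: mul_mx_tr_eq0; rewrite trmxK.
have At : (T^T *m T)^T = T^T *m T by rewrite trmx_mul trmxK.
have [l [E [l0 E0 pE AE cE]]] := spectral_projection At A0.
have [Et EE] := pE.
have trE : 0 < \tr E.
  rewrite lt_def; apply/andP; split.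
    by apply: contraNneq E0 => /(orth_proj_tr_eq0 pE)/eqP.
  by rewrite -EE -{2}Et mxtrace_mul_tr_ge0.
have lE : l * \tr E = \tr ((T *m E)^T *m (T *m E)).
  by rewrite trmx_mul Et -mulmxA (mulmxA T^T) AE -scalemxAr EE linearZ.
have l_gt0 : 0 < l.
  rewrite lt_def l0 /= -(pmulr_lge0 _ trE) lE.
  by rewrite -{2}[T *m E]trmxK mxtrace_mul_tr_ge0.
pose s := (Num.sqrt l)^-1.
have ss : s * s * l = 1.
  by rewrite -invfM -expr2 sqr_sqrtr ?ltW // mulVf.
pose W := s *: (T *m E).
have WW : W^T *m W = E.
  have -> : W^T = s *: (T *m E)^T by rewrite /W linearZ.
  rewrite /W -scalemxAl -scalemxAr scalerA trmx_mul Et -mulmxA.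
  by rewrite (mulmxA T^T) AE -scalemxAr EE scalerA ss scale1r.
have hA : intertwines rho rho (T^T *m T).
  by apply: intertwinesM (intertwines_tr hr hr' hT) hT.
have hE : intertwines rho rho E by move=> g; apply: cE; apply: hA.
have hW : intertwines rho rho' W.
  by apply: intertwinesZ; apply: intertwinesM hT hE.
have P1E : P1 *m E = E.
  apply: (scalerI l0); rewrite scalemxAr -AE !mulmxA; congr (_ *m _ *m _).
  by rewrite -{1}(proj1 pP1) -trmx_mul TP.
have EP1 : E *m P1 = E.
  by rewrite -{1}Et -{1}(proj1 pP1) -trmx_mul P1E Et.
have WP1 : W *m P1 = W by rewrite /W -scalemxAl -mulmxA EP1.
have QW : Q1 *m W = W by rewrite /W -scalemxAr mulmxA QT.
have UWt : U *m W^T = 0.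
  by rewrite -WP1 trmx_mul (proj1 pP1) mulmxA UP1 mul0mx.
have UtW : U^T *m W = 0 by rewrite -QW mulmxA UtQ1 mul0mx.
have WUt : W *m U^T = 0 by rewrite -[LHS]trmxK trmx_mul trmxK UWt trmx0.
have WtU : W^T *m U = 0 by rewrite -[LHS]trmxK trmx_mul trmxK UtW trmx0.
have eV : (U + W)^T *m (U + W) = U^T *m U + E.
  have -> : (U + W)^T = U^T + W^T by rewrite linearD.
  by rewrite mulmxDl !mulmxDr UtW WtU WW addr0 add0r.
exists (U + W); last by rewrite eV linearD /= ltrDl.
have UE : U *m E = 0 by rewrite -WW mulmxA UWt mul0mx.
split.
- exact: intertwinesD.
- rewrite mulmxDr QU; congr (_ + _).
  by rewrite -QW mulmxA mulmxBr QQ mulmxA QU.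
- rewrite mulmxDl UP; congr (_ + _).
  by rewrite -WP1 -mulmxA mulmxBl PP -mulmxA UP.
rewrite -mulmxA eV mulmxDl !mulmxDr !mulmxA UUU UE WUt mul0mx.
by rewrite addr0 add0r /W -scalemxAl -mulmxA EE.
Qed.

(** A partial isometry of maximal rank is an isometry from the image of P
    onto that of Q. *)
Lemma exists_isometry : exists U,
  [/\ intertwines rho rho' U, U^T *m U = P & U *m U^T = Q].
Proof.
pose ok m := `[< exists2 U, good U & \rank (U^T *m U) = m >].
have ok0 : exists m, ok m.
  exists 0%N; apply/asboolP; exists 0.
    by split; rewrite ?mul0mx ?mulmx0 // => g; rewrite mul0mx mulmx0.
  by rewrite mulmx0 mxrank0.
have okb m : ok m -> (m <= n)%N.
  by move=> /asboolP[U _ <-]; exact: rank_leq_col.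
case: (ex_maxnP ok0 okb) => m /asboolP[U gU rU] mmax.
have [hU QU UP UUU] := gU.
have [[UtUt UtU] [UUtt UUt]] := partial_isometry_tr UUU.
have UtUP : U^T *m U = P.
  apply/eqP/negPn/negP => /(extend_partial_isometry gU)[V gV].
  have [_ _ _ VVV] := gV; have [[_ VtV] _] := partial_isometry_tr VVV.
  rewrite !mxtrace_idem // ltr_nat rU ltnNge => /negP; apply; apply: mmax.
  by apply/asboolP; exists V.
exists U; split=> //; apply/eqP; rewrite eq_sym -subr_eq0; apply/eqP.
apply: orth_proj_tr_eq0.
  apply: orth_projB => //; first by rewrite mulmxA QU.
  by rewrite -mulmxA -{1}(proj1 projQ) -trmx_mul QU.
have := eq_tr 1%g; rewrite !orth_rep1 // !mul1mx linearB /= => <-.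
by rewrite mxtrace_mulC UtUP subrr.
Qed.

End Isometry.
End Intertwiner.

(** * Scalar products *)

Section Dot.
Variables (R : comNzRingType) (n : nat).
Implicit Types (a u v w : 'cV[R]_n) (X : 'M[R]_n).

Lemma dotvE u v : dotv u v = \sum_i u i 0 * v i 0.
Proof. by rewrite /dotv mxE; apply: eq_bigr => i _; rewrite mxE. Qed.

Lemma dotvC u v : dotv u v = dotv v u.
Proof. by rewrite !dotvE; apply: eq_bigr => i _; rewrite mulrC. Qed.

Lemma dotvDl u v w : dotv (u + v) w = dotv u w + dotv v w.
Proof. by rewrite /dotv linearD /= mulmxDl mxE. Qed.

Lemma dotvZl c u v : dotv (c *: u) v = c * dotv u v.
Proof. by rewrite /dotv linearZ /= -scalemxAl mxE. Qed.

Lemma dotvDr u v w : dotv u (v + w) = dotv u v + dotv u w.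
Proof. by rewrite dotvC dotvDl !(dotvC _ u). Qed.

Lemma dotvZr c u v : dotv u (c *: v) = c * dotv u v.
Proof. by rewrite dotvC dotvZl dotvC. Qed.

Lemma dotvNr u v : dotv u (- v) = - dotv u v.
Proof. by rewrite -scaleN1r dotvZr mulN1r. Qed.

Lemma dotvBl u v w : dotv (u - v) w = dotv u w - dotv v w.
Proof. by rewrite dotvDl [dotv (- v) w]dotvC dotvNr [dotv w v]dotvC. Qed.

Lemma dotv_mulmx X u v : dotv (X *m u) v = dotv u (X^T *m v).
Proof. by rewrite /dotv trmx_mul mulmxA. Qed.

Lemma dotv_deltal i v : dotv (delta_mx i 0) v = v i 0.
Proof.
rewrite dotvE (bigD1 i) //= big1 => [|j nj].
  by rewrite mxE !eqxx mul1r addr0.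
by rewrite mxE (negPf nj) mul0r.
Qed.

Lemma tr_mul_dotv u v : u^T *m v = (dotv u v)%:M.
Proof. by rewrite [LHS]mx11_scalar. Qed.

End Dot.

Section DotReal.
Variables (R : rcfType) (n : nat).
Implicit Types (u v : 'cV[R]_n).

Lemma dotv_ge0 v : 0 <= dotv v v.
Proof. by rewrite dotvE; apply: sumr_ge0 => i _; exact: sqr_ge0. Qed.

Lemma dotv_eq0 v : dotv v v = 0 -> v = 0.
Proof.
move=> v0; apply: trmx_inj; rewrite trmx0; apply: mul_mx_tr_eq0.
by rewrite trmxK tr_mul_dotv v0 raddf0.
Qed.

Lemma normalize v : v != 0 -> exists2 c, c != 0 & dotv (c *: v) (c *: v) = 1.
Proof.
move=> v0; have d0 : dotv v v != 0 by apply: contraNneq v0 => /dotv_eq0 ->.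
have d_gt0 : 0 < dotv v v by rewrite lt_def d0 dotv_ge0.
exists (Num.sqrt (dotv v v))^-1; first by rewrite invr_eq0 sqrtr_eq0 -ltNge.
rewrite dotvZl dotvZr mulrA -invfM -expr2 sqr_sqrtr ?ltW //.
by rewrite mulVf.
Qed.

(** The columns of A form an orthonormal basis of the image of P; they are
    split off one at a time. *)
Lemma orth_proj_frame k (P : 'M[R]_n) : orth_proj P -> \tr P = k%:R ->
  exists2 A : 'M[R]_(n, k), A^T *m A = 1%:M & A *m A^T = P.
Proof.
elim: k P => [|k IHk] P pP trP.
  exists 0; first by rewrite mulmx0 [RHS]flatmx0.
  by rewrite mul0mx (orth_proj_tr_eq0 pP).
have [Pt PP] := pP.
have [x Px] : exists x : 'cV_n, P *m x != 0.
  have : P != 0.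
    by apply/eqP => P0; move/eqP: trP; rewrite P0 mxtrace0 eq_sym pnatr_eq0.
  move=> /matrix0Pn[i [j Pij]]; exists (delta_mx j 0); rewrite -colE.
  by apply: contraNneq Pij => /colP/(_ i); rewrite !mxE => ->.
have [c c0 cu] := normalize Px; set a := c *: _ in cu.
have Pa : P *m a = a by rewrite /a -scalemxAr mulmxA PP.
have aP : a^T *m P = a^T by rewrite -{1}Pt -trmx_mul Pa.
have ata : a^T *m a = 1%:M by rewrite tr_mul_dotv cu.
have pP1 : orth_proj (P - a *m a^T).
  apply: orth_projB => //.
  - by split; rewrite ?trmx_mul ?trmxK // mulmxA -(mulmxA a) ata mulmx1.
  - by rewrite mulmxA Pa.
  - by rewrite -mulmxA aP.
have [||A AtA AAt] := IHk (P - a *m a^T) => //.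
  rewrite linearB /= trP mxtrace_mulC ata mxtrace1 -natrB //.
  by rewrite subn1.
have atA : a^T *m A = 0.
  have -> : A = (P - a *m a^T) *m A by rewrite -AAt -mulmxA AtA mulmx1.
  by rewrite mulmxA mulmxBr aP mulmxA ata mul1mx subrr mul0mx.
have Ata : A^T *m a = 0 by rewrite -[LHS]trmxK trmx_mul trmxK atA trmx0.
suff: exists2 B : 'M[R]_(n, 1 + k), B^T *m B = 1%:M & B *m B^T = P by [].
exists (row_mx a A).
  rewrite tr_row_mx mul_col_row ata atA Ata AtA.
  by rewrite -scalar_mx_block.
by rewrite tr_row_mx mul_row_col AAt addrC subrK.
Qed.

End DotReal.

(** * Left multiplication by imaginary octonions *)

(** The octonion units e_0 = 1, e_1, ..., e_7 multiply as e_i e_l = e_(i xor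
    l) up to sign; row i lists the l for which the sign is -1. *)
Definition oct_neg : seq (seq nat) :=
  [:: [::]; [:: 1; 3; 5; 6]; [:: 1; 2; 6; 7]; [:: 2; 3; 5; 7];
      [:: 1; 2; 3; 4]; [:: 2; 4; 5; 6]; [:: 3; 4; 6; 7]; [:: 1; 4; 5; 7]]%N.

Definition oct_sign (i l : nat) : bool := l \in nth [::] oct_neg i.

(** The sign of e_i (e_j e_l). *)
Definition oct_sign2 (i j l : nat) : bool :=
  oct_sign i (Nat.lxor j l) (+) oct_sign j l.

Definition bsign (b : bool) : int := if b then -1 else 1.

Lemma ord_iota0 (n : nat) (i : 'I_n) : (i : nat) \in iota 0 n.
Proof. by rewrite mem_iota /= ltn_ord. Qed.

Lemma ord_iota1 (n : nat) (i : 'I_n) : i.+1 \in iota 1 n.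
Proof. by rewrite mem_iota /= add1n ltnS ltn_ord. Qed.

Lemma lxor_lt8 (i : 'I_7) (l : 'I_8) : (Nat.lxor i.+1 l < 8)%N.
Proof.
have : all (fun i => all (fun l => Nat.lxor i l < 8)%N (iota 0 8)) (iota 1 7).
  by vm_compute.
by move=> /allP/(_ _ (ord_iota1 i))/allP/(_ _ (ord_iota0 l)).
Qed.

Definition oct_xor (i : 'I_7) (l : 'I_8) : 'I_8 := Ordinal (lxor_lt8 i l).

Lemma oct_xorC (i j : 'I_7) (l : 'I_8) :
  oct_xor i (oct_xor j l) = oct_xor j (oct_xor i l).
Proof.
apply: val_inj => /=.
have : all (fun i => all (fun j => all (fun l =>
    Nat.lxor i (Nat.lxor j l) == Nat.lxor j (Nat.lxor i l))
    (iota 0 8)) (iota 1 7)) (iota 1 7) by vm_compute.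
move=> /allP/(_ _ (ord_iota1 i))/allP/(_ _ (ord_iota1 j)).
by move=> /allP/(_ _ (ord_iota0 l))/eqP.
Qed.

Lemma oct_xorK (i : 'I_7) : involutive (oct_xor i).
Proof.
move=> l; apply: val_inj => /=.
have : all (fun i => all (fun l => Nat.lxor i (Nat.lxor i l) == l)
    (iota 0 8)) (iota 1 7) by vm_compute.
by move=> /allP/(_ _ (ord_iota1 i))/allP/(_ _ (ord_iota0 l))/eqP.
Qed.

Lemma oct_sign_antisym (i : 'I_7) (l : 'I_8) :
  oct_sign i.+1 (oct_xor i l) = ~~ oct_sign i.+1 l.
Proof.
have : all (fun i => all (fun l =>
    oct_sign i (Nat.lxor i l) == ~~ oct_sign i l) (iota 0 8)) (iota 1 7) by
      vm_compute.
by move=> /allP/(_ _ (ord_iota1 i))/allP/(_ _ (ord_iota0 l))/eqP.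
Qed.

Lemma oct_sign_anticomm (i j : 'I_7) (l : 'I_8) : i != j ->
  oct_sign2 i.+1 j.+1 l = ~~ oct_sign2 j.+1 i.+1 l.
Proof.
have : all (fun i => all (fun j => all (fun l => (i == j) ||
    (oct_sign2 i j l == ~~ oct_sign2 j i l))
    (iota 0 8)) (iota 1 7)) (iota 1 7) by vm_compute.
move=> /allP/(_ _ (ord_iota1 i))/allP/(_ _ (ord_iota1 j)).
by move=> /allP/(_ _ (ord_iota0 l)); rewrite eqSS => /orP[/eqP/val_inj->|/eqP];
  rewrite ?eqxx.
Qed.

Definition sum_iota (m n : nat) (F : nat -> int) : int :=
  foldr (fun k s => F k + s) 0 (iota m n).

Lemma sum_iota1E (n : nat) (F : nat -> int) :
  sum_iota 1 n F = \sum_(i < n) F i.+1.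
Proof.
rewrite -(big_mkord xpredT (fun i => F i.+1)) /sum_iota.
by rewrite -[1%N]addn0 iotaDl unlock /reducebig foldr_map /index_iota subn0.
Qed.

(** The left multiplications by the e_i and their products in pairs span all
    skew matrices of order 8.  This is their reproducing identity, entry by
    entry, in a form that a finite computation decides: the sum over all
    pairs (i, j) counts each bivector twice and the identity matrix 7 times. *)
Lemma oct_complete (k l p q : 'I_8) :
  \sum_(i < 7) ((k == oct_xor i l) && (p == oct_xor i q))%:R *
     (bsign (oct_sign i.+1 l (+) oct_sign i.+1 q) *+ 2) +
  \sum_(i < 7) \sum_(j < 7)
     ((k == oct_xor i (oct_xor j l)) && (p == oct_xor i (oct_xor j q)))%:R *
     bsign (oct_sign2 i.+1 j.+1 l (+) oct_sign2 i.+1 j.+1 q) =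
  (((k == p) && (l == q))%:R - ((k == q) && (l == p))%:R) *+ 8 +
  ((k == l) && (p == q))%:R *+ 7.
Proof.
have : all (fun k => all (fun l => all (fun p => all (fun q =>
    sum_iota 1 7 (fun i => if (k == Nat.lxor i l) && (p == Nat.lxor i q) then
      bsign (oct_sign i l (+) oct_sign i q) *+ 2 else 0) +
    sum_iota 1 7 (fun i => sum_iota 1 7 (fun j =>
      if (k == Nat.lxor i (Nat.lxor j l)) && (p == Nat.lxor i (Nat.lxor j q))
      then bsign (oct_sign2 i j l (+) oct_sign2 i j q) else 0)) ==
    (((k == p) && (l == q))%:R - ((k == q) && (l == p))%:R) *+ 8 +
    ((k == l) && (p == q))%:R *+ 7)
    (iota 0 8)) (iota 0 8)) (iota 0 8)) (iota 0 8).
  by vm_compute.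
move=> /allP/(_ _ (ord_iota0 k))/allP/(_ _ (ord_iota0 l)).
move=> /allP/(_ _ (ord_iota0 p))/allP/(_ _ (ord_iota0 q))/eqP.
rewrite !sum_iota1E => <-; congr (_ + _).
  apply: eq_bigr => i _; rewrite -!val_eqE /=.
  by case: ifP => _; rewrite ?mul0r ?mul1r.
apply: eq_bigr => i _; rewrite sum_iota1E.
apply: eq_bigr => j _; rewrite -!val_eqE /=.
by case: ifP => _; rewrite ?mul0r ?mul1r.
Qed.

Section OctonionMatrices.
Variable R : realFieldType.
Implicit Types (u v w : 'cV[R]_7) (N : 'M[R]_8).

Definition oct_unit (i : 'I_7) : 'M[R]_8 :=
  \matrix_(k, l) ((k == oct_xor i l)%:R * (-1) ^+ oct_sign i.+1 l).

Definition octL v : 'M[R]_8 := \sum_i v i 0 *: oct_unit i.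

Lemma octL_is_linear : linear octL.
Proof.
move=> a u v; rewrite /octL scaler_sumr -big_split /=.
by apply: eq_bigr => i _; rewrite !mxE scalerDl scalerA.
Qed.

HB.instance Definition _ :=
  GRing.isLinear.Build R 'cV[R]_7 'M[R]_8 _ octL octL_is_linear.

Lemma oct_unit_tr i : (oct_unit i)^T = - oct_unit i.
Proof.
apply/matrixP => k l;
  rewrite !mxE [l == _]eq_sym (can2_eq (oct_xorK i) (oct_xorK i)).
case: eqP => [->|_]; last by rewrite !mul0r oppr0.
by rewrite oct_sign_antisym !mul1r signrN.
Qed.

Lemma oct_unitM i j k l : (oct_unit i *m oct_unit j) k l =
  (k == oct_xor i (oct_xor j l))%:R * (-1) ^+ oct_sign2 i.+1 j.+1 l.
Proof.
rewrite mxE (bigD1 (oct_xor j l)) //= big1 => [|m nm]; last first.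
  by rewrite !mxE (negPf nm) mul0r mulr0.
by rewrite !mxE eqxx addr0 mul1r -mulrA -signr_addb.
Qed.

Lemma oct_unit_anticomm i j :
  oct_unit i *m oct_unit j + oct_unit j *m oct_unit i = (- (i == j)%:R *+ 2)%:M.
Proof.
apply/matrixP => k l; rewrite mxE !oct_unitM mxE.
have [->|nij] := eqVneq i j.
  rewrite oct_xorK /oct_sign2 -[Nat.lxor _ _]/(nat_of_ord (oct_xor j l)).
  rewrite oct_sign_antisym addNb addbb /= expr1 mulrN1.
  by case: (k == l); rewrite ?mulr1n ?mulr0n /=; ring.
rewrite oct_xorC oct_sign_anticomm // signrN mulrN addNr oppr0 mul0rn.
by rewrite mul0rn.
Qed.

Lemma octL_tr v : (octL v)^T = - octL v.
Proof.
rewrite /octL linear_sum -sumrN; apply: eq_bigr => i _.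
by rewrite linearZ /= oct_unit_tr scalerN.
Qed.

Lemma octL_anticomm u v :
  octL u *m octL v + octL v *m octL u = (- dotv u v *+ 2)%:M.
Proof.
rewrite /octL mulmx_suml [X in _ + X]mulmx_sumr -big_split /=.
transitivity (\sum_i (- (u i 0 * v i 0) *+ 2)%:M : 'M[R]_8).
  apply: eq_bigr => i _; rewrite mulmx_suml mulmx_sumr -big_split /=.
  rewrite (bigD1 i) //= big1 => [|j nj].
    rewrite addr0 -!scalemxAl -!scalemxAr !scalerA [v i 0 * _]mulrC -scalerDr.
    by rewrite oct_unit_anticomm eqxx scale_scalar_mx mulrnAr mulrN mulr1.
  rewrite -!scalemxAl -!scalemxAr !scalerA [v j 0 * _]mulrC -scalerDr.
  rewrite oct_unit_anticomm eq_sym (negPf nj) oppr0 mul0rn.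
  by rewrite scale_scalar_mx mulr0 raddf0.
rewrite -(raddf_sum (@scalar_mx R 8)); congr (_%:M).
rewrite sumrMnl sumrN /dotv mxE; congr (- _ *+ 2).
by apply: eq_bigr => i _; rewrite mxE.
Qed.

Lemma octL_sq v : octL v *m octL v = (- dotv v v)%:M.
Proof.
apply: (@scalerI _ _ (2 : R)); first by rewrite pnatr_eq0.
by rewrite !scaler_nat mulr2n octL_anticomm raddfMn.
Qed.

(** The expansion of a skew matrix in the orthogonal family of the vectors
    and bivectors, obtained by contracting [oct_complete] with N. *)
Lemma octL_unit_complete N : N^T = - N ->
  N *+ 16 = \sum_i (\tr ((oct_unit i)^T *m N) *+ 2) *: oct_unit i +
   \sum_i \sum_j \tr ((oct_unit i *m oct_unit j)^T *m N) *:
     (oct_unit i *m oct_unit j).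
Proof.
move=> Nt.
have trE (X : 'M[R]_8) : \tr (X^T *m N) = \sum_q \sum_p X p q * N p q.
  apply: eq_bigr => q _; rewrite mxE; apply: eq_bigr => p _; rewrite mxE.
  by [].
have Npq p q : N q p = - N p q by have /matrixP/(_ p q) := Nt; rewrite !mxE.
apply/matrixP => k l; apply: esym.
pose C p q : R := \sum_(i < 7) ((k == oct_xor i l) && (p == oct_xor i q))%:R *
     ((-1) ^+ (oct_sign i.+1 l (+) oct_sign i.+1 q) *+ 2) +
  \sum_(i < 7) \sum_(j < 7)
     ((k == oct_xor i (oct_xor j l)) && (p == oct_xor i (oct_xor j q)))%:R *
     (-1) ^+ (oct_sign2 i.+1 j.+1 l (+) oct_sign2 i.+1 j.+1 q).
have CE p q : C p q =
  (((k == p) && (l == q))%:R - ((k == q) && (l == p))%:R) *+ 8 +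
  ((k == l) && (p == q))%:R *+ 7.
  have bE b : (bsign b)%:~R = (-1) ^+ b :> R by case: b.
  transitivity (((((k == p) && (l == q))%:R - ((k == q) && (l == p))%:R) *+ 8 +
      ((k == l) && (p == q))%:R *+ 7 : int)%:~R : R); last first.
    by rewrite rmorphD !rmorphMn rmorphB /=; do 3!case: (_ && _).
  rewrite -oct_complete rmorphD !rmorph_sum /=; congr (_ + _).
    apply: eq_bigr => i _; rewrite rmorphM !mulr2n rmorphD /= bE.
    by case: (_ && _).
  apply: eq_bigr => i _; rewrite rmorph_sum; apply: eq_bigr => j _.
  by rewrite rmorphM /= bE; case: (_ && _).
transitivity (\sum_q \sum_p C p q * N p q).
  rewrite mxE !summxE.
  have -> : \sum_i (\sum_j \tr ((oct_unit i *m oct_unit j)^T *m N) *: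
      (oct_unit i *m oct_unit j)) k l = \sum_q \sum_p (\sum_i \sum_j
      ((k == oct_xor i (oct_xor j l)) && (p == oct_xor i (oct_xor j q)))%:R *
     (-1) ^+ (oct_sign2 i.+1 j.+1 l (+) oct_sign2 i.+1 j.+1 q)) * N p q.
    under [RHS]eq_bigr => q _.
      under eq_bigr => p _ do (rewrite mulr_suml;
        under eq_bigr => i _ do rewrite mulr_suml).
      rewrite exchange_big /=; under eq_bigr => i _ do rewrite exchange_big /=.
      over.
    rewrite exchange_big /=; apply: eq_bigr => i _;
      rewrite summxE exchange_big /=.
    apply: eq_bigr => j _; rewrite mxE trE mulr_suml; apply: eq_bigr => q _.
    rewrite mulr_suml; apply: eq_bigr => p _; rewrite !oct_unitM signr_addb.
    by rewrite -mulnb natrM; ring.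
  have -> : \sum_i ((\tr ((oct_unit i)^T *m N) *+ 2) *: oct_unit i) k l =
    \sum_q \sum_p (\sum_i ((k == oct_xor i l) && (p == oct_xor i q))%:R *
     ((-1) ^+ (oct_sign i.+1 l (+) oct_sign i.+1 q) *+ 2)) * N p q.
    under [RHS]eq_bigr => q _.
      under eq_bigr => p _ do rewrite mulr_suml.
      rewrite exchange_big /=; over.
    rewrite exchange_big /=; apply: eq_bigr => i _.
    rewrite mxE trE -mulr_natr !mulr_suml; apply: eq_bigr => q _.
    rewrite !mulr_suml; apply: eq_bigr => p _; rewrite !mxE signr_addb.
    by rewrite -mulnb natrM -[in RHS]mulr_natr; ring.
  rewrite -big_split /=; apply: eq_bigr => q _.
  by rewrite -big_split /=; apply: eq_bigr => p _; rewrite -mulrDl.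
transitivity ((\sum_q \sum_p ((k == p) && (l == q))%:R * N p q) *+ 8 -
    (\sum_q \sum_p ((l == p) && (k == q))%:R * N p q) *+ 8 +
    (\sum_q \sum_p ((k == l) && (p == q))%:R * N p q) *+ 7).
  rewrite -!sumrMnl -sumrB -big_split /=; apply: eq_bigr => q _.
  rewrite -!sumrMnl -sumrB -big_split /=; apply: eq_bigr => p _.
  by rewrite CE [(l == p) && _]andbC; ring.
have pick a b (F : 'I_8 -> 'I_8 -> R) :
    \sum_q \sum_p ((a == p) && (b == q))%:R * F p q = F a b.
  rewrite (bigD1 b) //= [X in _ + X]big1 => [|q nq]; last first.
    by apply: big1 => p _; rewrite [b == q]eq_sym (negPf nq) andbF mul0r.
  rewrite (bigD1 a) //= !big1 ?addr0 => [|p np]; last first.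
    by rewrite eq_sym (negPf np) mul0r.
  by rewrite !eqxx mul1r.
have diag0 : \sum_q \sum_p ((k == l) && (p == q))%:R * N p q = 0.
  apply: big1 => q _; apply: big1 => p _.
  case: (eqVneq p q) => [->|_]; last by rewrite andbF mul0r.
  have := Npq q q => /eqP; rewrite -addr_eq0 -mulr2n mulrn_eq0 /=.
  by move=> /eqP ->; rewrite mulr0.
rewrite !pick diag0 mul0rn addr0 (Npq k l) mulNrn opprK -mulrnDr.
by rewrite mulmxnE.
Qed.

End OctonionMatrices.

(** * Vectors, bivectors and involutions on the spinors *)

Section Spinor.
Variable R : rcfType.
Implicit Types (u v w : 'cV[R]_7) (a b : 'cV[R]_8) (N U P X : 'M[R]_8).

Lemma octL_sqr u v a : dotv (octL u *m a) (octL v *m a) = dotv u v * dotv a a.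
Proof.
have h x y : dotv (octL x *m a) (octL y *m a) = - dotv a (octL x *m octL y *m
  a).
  by rewrite dotv_mulmx octL_tr mulNmx dotvNr mulmxA.
apply: (@mulfI _ (2 : R)); first by rewrite pnatr_eq0.
rewrite mulr_natl mulr2n {2}dotvC !h -opprD -dotvDr -mulmxDl octL_anticomm.
by rewrite mul_scalar_mx dotvZr; ring.
Qed.

Lemma octL_inj0 v : octL v = 0 -> v = 0.
Proof.
move=> v0; apply: dotv_eq0; have := octL_sq v; rewrite v0 mul0mx.
by move=> /matrixP/(_ 0 0); rewrite !mxE eqxx mulr1n => /esym/eqP;
  rewrite oppr_eq0 => /eqP.
Qed.

Lemma octL_spinor_inj v a : a != 0 -> octL v *m a = 0 -> v = 0.
Proof.
move=> a0 va; apply: dotv_eq0; have := octL_sqr v v a.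
rewrite va /dotv mulmx0 mxE => /esym/eqP; rewrite mulf_eq0 => /orP[/eqP//|].
by move=> /eqP/dotv_eq0 e; rewrite e eqxx in a0.
Qed.

Lemma oct_unitE i : oct_unit R i = octL (delta_mx i 0).
Proof.
rewrite /octL (bigD1 i) //= big1 => [|j nj].
  by rewrite mxE !eqxx scale1r addr0.
by rewrite mxE (negPf nj) scale0r.
Qed.

(** The spinor a and its images under an orthonormal basis of E are eight
    orthonormal vectors of R^8, hence a basis. *)
Lemma octL_surj a b : dotv a a = 1 -> dotv a b = 0 -> exists v, octL v *m a = b.
Proof.
move=> a1 ab; pose M : 'M[R]_(7, 8) := \matrix_i (oct_unit R i *m a)^T.
have Mrow i : row i M = (octL (delta_mx i 0) *m a)^T by rewrite rowK oct_unitE.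
have Ma : M *m a = 0.
  apply/row_matrixP => i; rewrite row_mul Mrow row0 tr_mul_dotv.
  have := dotv_mulmx (octL (delta_mx i 0)) a a;
    rewrite octL_tr mulNmx dotvNr dotvC.
  by move=> /eqP; rewrite -addr_eq0 -mulr2n mulrn_eq0 /= => /eqP->;
    rewrite raddf0.
have MM : M *m M^T = 1%:M.
  apply/matrixP => i j; transitivity ((row i M *m (row j M)^T) 0 0).
    by rewrite !mxE; apply: eq_bigr => k _; rewrite !mxE.
  rewrite !Mrow trmxK tr_mul_dotv octL_sqr a1 mulr1 dotvE (bigD1 i) //= big1 =>
    [|k nk].
    by rewrite !mxE !eqxx addr0 mul1r mulr1n andbT.
  by rewrite mxE (negPf nk) mul0r.
have OO : col_mx a^T M *m (col_mx a^T M)^T = 1%:M.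
  rewrite tr_col_mx trmxK mul_col_row tr_mul_dotv a1 Ma MM.
  have -> : a^T *m M^T = 0 by rewrite -trmx_mul Ma trmx0.
  by rewrite -scalar_mx_block.
have OtO : (col_mx a^T M)^T *m col_mx a^T M = 1%:M := @mulmx1C R 8 _ _ OO.
exists (M *m b).
rewrite -[RHS]mul1mx -OtO -mulmxA mul_col_mx tr_mul_dotv ab raddf0.
rewrite tr_col_mx mul_row_col mulmx0 add0r /octL mulmx_suml.
apply/colP => k; rewrite summxE [RHS]mxE; apply: eq_bigr => i _.
by rewrite -scalemxAl !mxE mulrC.
Qed.

Lemma octL_swap u v :
  octL u *m octL v = - (octL v *m octL u) - (dotv u v *+ 2)%:M.
Proof.
apply: (addIr (octL v *m octL u)); rewrite octL_anticomm mulNrn raddfN.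
by rewrite addrAC addNr add0r.
Qed.

Lemma octL_comm2 u w v :
  octL u *m octL w *m octL v - octL v *m (octL u *m octL w) =
  octL ((dotv u v *+ 2) *: w - (dotv w v *+ 2) *: u).
Proof.
rewrite -mulmxA (octL_swap w v) mulmxBr mulmxN (mulmxA (octL u)) (octL_swap u
  v).
rewrite mulmxBl mulNmx mul_scalar_mx mul_mx_scalar opprD !opprK mulmxA.
by rewrite linearB /= !linearZ /= -[X in X - _]addrA [X in X - _]addrC addrK.
Qed.

(** The skew matrices orthogonal to E; they form the Lie algebra of Spin(7). *)
Definition bivector N : Prop :=
  N^T = - N /\ forall v, \tr (octL v *m N) = 0.

(** By [octL_unit_complete], N is a combination of products of two vectors,
    whose commutators with a vector are vectors. *)
Lemma bivector_comm N v : bivector N ->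
  exists w, N *m octL v - octL v *m N = octL w.
Proof.
move=> [Nt NE]; pose c i j := \tr ((oct_unit R i *m oct_unit R j)^T *m N).
have eN : N = \sum_i \sum_j (16%:R^-1 * c i j) *:
    (octL (delta_mx i 0) *m octL (delta_mx j 0)).
  apply: (@scalerI _ _ (16%:R : R)); first by rewrite pnatr_eq0.
  rewrite scaler_nat octL_unit_complete // big1 => [|i _]; last first.
    by rewrite oct_unit_tr mulNmx oct_unitE linearN /= NE oppr0 mul0rn scale0r.
  rewrite add0r scaler_sumr; apply: eq_bigr => i _; rewrite scaler_sumr.
  apply: eq_bigr => j _; rewrite -!oct_unitE scalerA mulrA mulfV ?mul1r //.
  by rewrite pnatr_eq0.
eexists; rewrite {1 2}eN mulmx_suml mulmx_sumr -sumrB.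
under eq_bigr => i _.
  rewrite mulmx_suml mulmx_sumr -sumrB.
  under eq_bigr => j _ do
    rewrite -scalemxAl -scalemxAr -scalerBr octL_comm2 -linearZ.
  rewrite -linear_sum; over.
by rewrite -linear_sum.
Qed.

Lemma bivector_central N : bivector N ->
  (forall v, N *m octL v = octL v *m N) -> N = 0.
Proof.
move=> [Nt NE] Nc; apply: (@scalerI _ _ (16%:R : R));
  first by rewrite pnatr_eq0.
have trN : \tr N = 0.
  have := mxtrace_tr N; rewrite Nt linearN /= => /eqP.
  by rewrite eq_sym -addr_eq0 -mulr2n mulrn_eq0 => /eqP.
rewrite scaler_nat scaler0 octL_unit_complete // !big1 ?addr0 // => i _.
  apply: big1 => j _; rewrite trmx_mul !oct_unit_tr !oct_unitE mulNmx mulmxN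
    opprK.
  set u := delta_mx i 0; set v := delta_mx j 0.
  have e1 : \tr (octL v *m octL u *m N) = \tr (octL u *m octL v *m N).
    by rewrite -mulmxA -Nc mulmxA mxtrace_mulC mulmxA.
  have : \tr ((octL u *m octL v + octL v *m octL u) *m N) = 0.
    by rewrite octL_anticomm mul_scalar_mx linearZ /= trN mulr0.
  rewrite mulmxDl linearD /= e1 -mulr2n => /eqP; rewrite mulrn_eq0 /=.
  by move=> /eqP ->; rewrite scale0r.
by rewrite oct_unit_tr mulNmx oct_unitE linearN /= NE oppr0 mul0rn scale0r.
Qed.

(** Bracketing with N maps E to E, and not to 0.  As N^2 = -1, a bracket v =
    [N, v0] satisfies N v N = v, so v anticommutes with N; then u = - N v is
    again a vector, half of the bracket - [N, v], and u v = - N v^2 = N for v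
    of norm 1. *)
Lemma bivector_decomposable N : bivector N -> N *m N = - 1%:M ->
  exists u v, [/\ dotv u u = 1, dotv v v = 1 & N = octL u *m octL v].
Proof.
move=> bN NN.
have [v0 Nv0] : exists v, N *m octL v != octL v *m N.
  apply: contrapT => h; have N0 : N = 0.
    apply: bivector_central => // v; apply/eqP; apply: contraPT h => nv.
    by apply; exists v.
  move: NN; rewrite N0 mul0mx => /eqP; rewrite eq_sym oppr_eq0.
  by move=> /eqP/matrixP/(_ 0 0)/eqP; rewrite !mxE eqxx oner_eq0.
have [v1 ev1] := bivector_comm v0 bN.
have v1_neq0 : v1 != 0.
  apply: contraNneq Nv0 => v10; rewrite -subr_eq0 ev1 v10.
  by rewrite linear0.
have NvN1 : N *m octL v1 *m N = octL v1.
  rewrite -ev1 mulmxBr mulmxBl !mulmxA NN -!mulmxA NN !mulmxN mulmx1.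
  by rewrite !mulNmx mul1mx opprK addrC.
have [c c0 v_unit] := normalize v1_neq0; set v := c *: v1 in v_unit.
have NvN : N *m octL v *m N = octL v.
  by rewrite /v linearZ /= -scalemxAr -scalemxAl NvN1.
have Nv : N *m octL v = - (octL v *m N).
  by rewrite -[in LHS]NvN !mulmxA NN !mulNmx mul1mx.
have vv : octL v *m octL v = - 1%:M by rewrite octL_sq v_unit raddfN.
have [w ew] := bivector_comm v bN.
pose u := - (2%:R^-1 *: w).
have eu : octL u = - (N *m octL v).
  rewrite /u linearN /= linearZ /= -ew {2}Nv -[octL v *m N]opprK -Nv.
  by rewrite opprK -mulr2n -scaler_nat scalerA mulVf ?scale1r // pnatr_eq0.
exists u, v; split=> //.
  have : octL u *m octL u = octL v *m octL v.
    by rewrite eu mulNmx mulmxN opprK mulmxA NvN.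
  by rewrite octL_sq vv => /matrixP/(_ 0 0);
    rewrite !mxE eqxx mulr1n => /oppr_inj.
by rewrite eu mulNmx -mulmxA vv mulmxN mulmx1 opprK.
Qed.

Definition anticomm_by U v := octL v *m U = - (U *m octL v).

Lemma mxtrace_octL_sym v U : U^T = U -> \tr (octL v *m U) = 0.
Proof.
move=> Ut; have := mxtrace_tr (octL v *m U).
rewrite trmx_mul Ut octL_tr mulmxN linearN /= mxtrace_mulC => /eqP.
by rewrite eq_sym -addr_eq0 -mulr2n mulrn_eq0 => /eqP.
Qed.

(** The product v w U is skew of square -1, and it is orthogonal to E because
    both v and w anticommute with U: it is a bivector as in
    [bivector_decomposable]. *)
Lemma quadrivector_decomposable U v w : U^T = U -> U *m U = 1%:M ->
  anticomm_by U v -> anticomm_by U w ->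
  dotv v v = 1 -> dotv w w = 1 -> dotv v w = 0 ->
  exists x y, [/\ dotv x x = 1, dotv y y = 1 &
    U = octL w *m octL v *m (octL x *m octL y)].
Proof.
move=> Ut UU Uv Uw v1 w1 vw.
have vv : octL v *m octL v = - 1%:M by rewrite octL_sq v1 raddfN.
have ww : octL w *m octL w = - 1%:M by rewrite octL_sq w1 raddfN.
have wv : octL w *m octL v = - (octL v *m octL w).
  by rewrite octL_swap dotvC vw mul0rn raddf0 subr0.
pose B := octL v *m octL w.
have BU : B *m U = U *m B.
  by rewrite /B -mulmxA Uw mulmxN mulmxA Uv mulNmx opprK mulmxA.
have Bt : B^T = - B by rewrite /B trmx_mul !octL_tr mulNmx mulmxN opprK wv.
have BB : B *m B = - 1%:M.
  rewrite /B mulmxA -(mulmxA (octL v)) wv mulmxN mulmxA vv !mulNmx mul1mx.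
  by rewrite opprK ww.
have bY : bivector (B *m U).
  split; first by rewrite trmx_mul Ut Bt mulmxN BU.
  move=> x; set t := \tr _.
  have e1 : t = - \tr (octL w *m octL x *m octL v *m U).
    rewrite /t /B -!mulmxA Uw !mulmxN linearN /= !mulmxA.
    by rewrite [in LHS]mxtrace_mulC !mulmxA.
  have e2 : \tr (octL w *m octL x *m octL v *m U) = t.
    rewrite (octL_swap w x) mulmxBl mulmxBl mul_scalar_mx -scalemxAl.
    rewrite linearB /= linearZ /= (mxtrace_octL_sym _ Ut) mulr0 subr0.
    by rewrite !mulNmx -(mulmxA (octL x)) wv mulmxN mulNmx opprK /t mulmxA.
  move: e1; rewrite e2 => /eqP; rewrite -addr_eq0 -mulr2n mulrn_eq0 /=.
  by move=> /eqP.
have YY : B *m U *m (B *m U) = - 1%:M.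
  by rewrite mulmxA -(mulmxA B U) -BU (mulmxA B B) BB !mulNmx mul1mx UU.
have [x [y [x1 y1 e]]] := bivector_decomposable bY YY.
exists x, y; split=> //; rewrite -e wv -/B.
by rewrite mulNmx mulmxA BB mulNmx mul1mx opprK.
Qed.

Lemma orth_proj_plane P : orth_proj P -> \tr P = 2%:R ->
  exists a b, [/\ dotv a a = 1, dotv b b = 1, dotv a b = 0 &
    P = a *m a^T + b *m b^T].
Proof.
move=> pP tP; have [A AtA AAt] := orth_proj_frame pP tP.
have dotA i j : dotv (col i A) (col j A) = (i == j)%:R.
  have /matrixP/(_ i j) := AtA; rewrite !mxE => <-.
  by rewrite dotvE; apply: eq_bigr => k _; rewrite !mxE.
exists (col 0 A), (col 1 A); rewrite !dotA; split=> //.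
rewrite -AAt; apply/matrixP => i j; rewrite !mxE !big_ord_recl !big_ord0 !mxE.
by rewrite !addr0; congr (_ * _ + _ * _); congr (A _ _); apply: val_inj.
Qed.

(** For an orthonormal basis a, b of the plane, the vector v with v a = b
    also maps b to - a, so it preserves the plane.  Conversely a vector that
    preserves the plane maps a to a multiple of b, being skew, and is
    determined by it. *)
Lemma orth_proj_plane_line P : orth_proj P -> \tr P = 2%:R ->
  exists v, [/\ v != 0, octL v *m P = P *m octL v &
    forall w, octL w *m P = P *m octL w -> exists c, w = c *: v].
Proof.
move=> pP tP; have [a [b [a1 b1 ab eP]]] := orth_proj_plane pP tP.
have [v va] := octL_surj a1 ab.
have vb : octL v *m b = - a.
  rewrite -va mulmxA octL_sq mul_scalar_mx.
  have := octL_sqr v v a; rewrite va a1 b1 mulr1 => <-.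
  by rewrite scaleN1r.
have a0 : a != 0.
  by apply/eqP => a0; move/eqP: a1; rewrite a0 /dotv mulmx0 mxE eq_sym oner_eq0.
have vP : octL v *m P = b *m a^T - a *m b^T.
  by rewrite eP mulmxDr !mulmxA va vb mulNmx.
exists v; split.
- apply: contraNneq a0 => v0; move: vb; rewrite v0 linear0 mul0mx => /eqP.
  by rewrite eq_sym oppr_eq0.
- have -> : P *m octL v = - (octL v *m P)^T.
    by rewrite trmx_mul (proj1 pP) octL_tr mulmxN opprK.
  by rewrite vP linearB /= !trmx_mul !trmxK opprB.
move=> w wP; exists (dotv b (octL w *m a)).
apply/eqP; rewrite -subr_eq0; apply/eqP; apply: (octL_spinor_inj a0).
rewrite linearB linearZ /= mulmxBl -scalemxAl va.
have Pa : P *m a = a.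
  rewrite eP mulmxDl -!mulmxA !tr_mul_dotv a1 dotvC ab raddf0 mulmx0 addr0.
  by rewrite mulmx1.
have : dotv a (octL w *m a) = 0.
  have := dotv_mulmx (octL w) a a; rewrite octL_tr mulNmx dotvNr dotvC => /eqP.
  by rewrite -addr_eq0 -mulr2n mulrn_eq0 => /eqP.
rewrite -{3}Pa mulmxA wP {1}eP => aw.
rewrite -mulmxA mulmxDl -!mulmxA !tr_mul_dotv aw raddf0 mulmx0 add0r.
by rewrite mul_mx_scalar subrr.
Qed.

(** Skew matrices of order 4 have 6 coordinates, vectors of E have 7. *)
Lemma exists_skew_kernel (A : 'M[R]_(8, 4)) :
  exists2 v, v != 0 & A^T *m octL v *m A = 0.
Proof.
(* the positions (ia q, ja q) run over the entries above the diagonal *)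
pose ia (q : 'I_6) : 'I_4 := inord (nth 0 [:: 0; 0; 0; 1; 1; 2] q)%N.
pose ja (q : 'I_6) : 'I_4 := inord (nth 0 [:: 1; 2; 3; 2; 3; 3] q)%N.
pose B : 'M[R]_(7, 6) := \matrix_(i, q) (A^T *m oct_unit R i *m A) (ia q) (ja
  q).
have [i xi0] : exists i, row i (kermx B) != 0.
  have : kermx B != 0.
    by rewrite kermx_eq0 /row_free neq_ltn (leq_ltn_trans (rank_leq_col B)).
  move=> /matrix0Pn[i [j Bij]]; exists i; apply: contraNneq Bij => /rowP/(_ j).
  by rewrite !mxE => ->.
pose v : 'cV[R]_7 := (row i (kermx B))^T; exists v; first by rewrite trmx_eq0.
set X := _ *m A.
have Xt : X^T = - X.
  by rewrite /X !trmx_mul trmxK octL_tr mulNmx mulmxN mulmxA.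
have Xq q : X (ia q) (ja q) = 0.
  have /rowP/(_ q) : v^T *m B = 0.
    by rewrite trmxK -row_mul mulmx_ker row0.
  move=> e; transitivity ((v^T *m B) 0 q); last by rewrite e mxE.
  rewrite [RHS]mxE /X /octL mulmx_sumr mulmx_suml summxE.
  apply: eq_bigr => k _; rewrite -scalemxAr -scalemxAl mxE.
  by rewrite [B _ _]mxE [v^T _ _]mxE.
have Xlt (k l : 'I_4) : (k < l)%N -> X k l = 0.
  move=> kl; suff [q [<- <-]] : exists q, ia q = k /\ ja q = l by exact: Xq.
  have find q : (nth 0 [:: 0; 0; 0; 1; 1; 2] (q : 'I_6))%N = k ->
      (nth 0 [:: 1; 2; 3; 2; 3; 3] q)%N = l -> exists q, ia q = k /\ ja q = l.
    by move=> ek el; exists q; rewrite /ia /ja ek el !inord_val.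
  case: k l kl find => [[|[|[|[|//]]]] hk] [[|[|[|[|//]]]] hl] //= _ find.
  - exact: (find (@Ordinal 6 0 isT)).
  - exact: (find (@Ordinal 6 1 isT)).
  - exact: (find (@Ordinal 6 2 isT)).
  - exact: (find (@Ordinal 6 3 isT)).
  - exact: (find (@Ordinal 6 4 isT)).
  exact: (find (@Ordinal 6 5 isT)).
apply/matrixP => k l; rewrite [RHS]mxE; case: (ltngtP k l) => [||/val_inj->].
- exact: Xlt.
- move=> /Xlt e; have /matrixP/(_ k l) := Xt; rewrite [LHS]mxE [RHS]mxE e.
  by move=> /esym/eqP; rewrite oppr_eq0 => /eqP.
have /matrixP/(_ l l) := Xt; rewrite [LHS]mxE [RHS]mxE => /eqP.
by rewrite -addr_eq0 -mulr2n mulrn_eq0 => /eqP.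
Qed.

(** The eigenspace of U for 1 has dimension 4, so [exists_skew_kernel] gives
    v with (1 + U) v (1 + U) = 0.  The matrix (1 - U) v (1 - U) has the same
    norm, since U and v^2 U have trace 0; so it vanishes too, and the
    difference of the two is 2 (v U + U v). *)
Lemma exists_anticommuting U : U^T = U -> U *m U = 1%:M -> \tr U = 0 ->
  exists2 v, v != 0 & anticomm_by U v.
Proof.
move=> Ut UU trU; pose P := 2%:R^-1 *: (1%:M + U).
have two : (2%:R : R) != 0 by rewrite pnatr_eq0.
have pP : orth_proj P.
  apply: orth_proj_half; rewrite ?mulmx1 ?mul1mx //.
  by split; rewrite ?trmx1 ?mulmx1.
have trP : \tr P = 4%:R.
  rewrite /P linearZ /= linearD /= mxtrace1 trU addr0.
  by apply: (mulfI two); rewrite mulrA mulfV // mul1r -natrM.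
have [A AtA AAt] := orth_proj_frame pP trP.
have [v v0 vA] := exists_skew_kernel A.
exists v => //.
have plus0 : (1%:M + U) *m octL v *m (1%:M + U) = 0.
  have e : P *m octL v *m P = 0.
    by rewrite -AAt -!mulmxA (mulmxA A^T) (mulmxA (A^T *m octL v)) vA mul0mx
      mulmx0.
  have := e; rewrite /P -!scalemxAl -scalemxAr => /eqP.
  by rewrite !scaler_eq0 invr_eq0 (negPf two) /= => /eqP.
pose M := (1%:M - U) *m octL v *m (1%:M - U).
have trJJU : \tr (octL v *m octL v *m U) = 0.
  by rewrite octL_sq mul_scalar_mx linearZ /= trU mulr0.
have trM : \tr (M *m M^T) = 0.
  have Vt : (1%:M - U)^T = 1%:M - U by rewrite linearB /= trmx1 Ut.
  have VV : (1%:M - U) *m (1%:M - U) = 2%:R *: (1%:M - U).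
    rewrite mulmxBl !mulmxBr UU !mulmx1 mul1mx opprB scaler_nat mulr2n.
    by rewrite addrA.
  have Mt : M^T = - M.
    by rewrite /M !trmx_mul octL_tr Vt mulNmx mulmxN mulmxA.
  have quad (s : R) : (1%:M + s *: U) *m octL v *m (1%:M + s *: U) *m octL v =
      octL v *m octL v + s *: (U *m octL v *m octL v) +
      s *: (octL v *m U *m octL v) + (s * s) *: (U *m octL v *m U *m octL v).
    have h W : (1%:M + W) *m octL v *m (1%:M + W) *m octL v =
        octL v *m octL v + W *m octL v *m octL v +
        octL v *m W *m octL v + W *m octL v *m W *m octL v.
      by rewrite mulmxDl mul1mx mulmxDr mulmx1 !mulmxDl !addrA.
    by rewrite h -!(scalemxAl, scalemxAr) scalerA.
  have := congr1 (fun Z => \tr (Z *m octL v)) plus0.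
  have := quad 1; rewrite scale1r => ->.
  rewrite mul0mx mxtrace0 !linearD /= mul1r !linearZ /=.
  have t1 : \tr (U *m octL v *m octL v) = 0 by rewrite -mulmxA mxtrace_mulC.
  have t2 : \tr (octL v *m U *m octL v) = 0 by rewrite mxtrace_mulC mulmxA.
  rewrite t1 t2 !mulr0 !addr0 mul1r => e.
  rewrite Mt mulmxN linearN /= /M mulmxA -[_ *m (1%:M - U) *m _]mulmxA.
  rewrite (mulmxA (1%:M - U)) VV -!(scalemxAl, scalemxAr) linearZ /=.
  rewrite mxtrace_mulC !mulmxA VV -!scalemxAl linearZ /=.
  have := quad (-1); rewrite scaleN1r => ->.
  rewrite !linearD /= !linearZ /= t1 t2 !mulr0 !addr0 mulrNN !mul1r e.
  by rewrite !mulr0 oppr0.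
have minus0 : M = 0 := mxtrace_mul_tr_eq0 trM.
have e1 : (1%:M + U) *m octL v *m (1%:M + U) =
    octL v + U *m octL v + (octL v *m U + U *m octL v *m U).
  by rewrite mulmxDl mul1mx mulmxDr mulmx1 mulmxDl.
have e2 : M = octL v - U *m octL v - (octL v *m U - U *m octL v *m U).
  by rewrite /M mulmxBl mul1mx mulmxBr mulmx1 mulmxBl.
have : (2%:R : R) *: (octL v *m U + U *m octL v) = 0.
  rewrite -[RHS](subrr 0) -{1}plus0 -minus0 e1 e2 scaler_nat mulr2n.
  move: (octL v) (U *m octL v) (octL v *m U) (U *m octL v *m U) => x y z t.
  by apply/matrixP => i j; rewrite !mxE; ring.
by move=> /eqP; rewrite scaler_eq0 (negPf two) /= addr_eq0 => /eqP.
Qed.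

End Spinor.

(** * Matrices that commute with the spinor action up to a character *)

Section Core.
Variables (R : rcfType) (Gamma : groupType).
Variables (s : Gamma -> 'M[R]_8) (g : Gamma -> 'M[R]_7) (chi : Gamma -> R).
Hypotheses (hs : orth_rep s) (hg : orth_rep g).
Hypothesis sJ : forall x v, s x *m octL v = octL (g x *m v) *m s x.
Hypothesis hchi : orth_rep (fun x => chi x *: s x).
Hypothesis chi2 : forall x, chi x * chi x = 1.
Hypothesis chi_tr : forall x, chi x * \tr (s x) = \tr (s x).
Hypothesis chiN1 : exists x, chi x != 1.
Hypothesis no_line : forall v : 'cV[R]_7, v != 0 -> ~ (forall x, exists c, g x
  *m v = c *: v).
Implicit Types (u v w : 'cV[R]_7) (N U P X Y : 'M[R]_8).

(** The intertwiners from s to chi s; chi is its own inverse. *)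
Let twisted U := forall x, s x *m U = chi x *: (U *m s x).

Lemma spinor_action_inj x X Y : X *m s x = Y *m s x -> X = Y.
Proof.
move=> /(congr1 (fun Z : 'M[R]_8 => Z *m (s x)^T)).
by rewrite -!mulmxA orth_repMt // !mulmx1.
Qed.

Lemma intertwines_twisted U : intertwines s (fun x => chi x *: s x) U ->
  twisted U.
Proof.
move=> hU x; rewrite -hU -scalemxAl scalerA chi2 scale1r.
by [].
Qed.

Lemma twisted_intertwines U : twisted U -> intertwines s (fun x => chi x *: s
  x) U.
Proof. by move=> hU x; rewrite -scalemxAl hU scalerA chi2 scale1r. Qed.

Lemma twisted_trmx U : twisted U -> twisted U^T.
Proof.
move=> /twisted_intertwines hU x; have := intertwines_tr hs hchi hU x.
by rewrite /= -scalemxAr.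
Qed.

Lemma twistedD U X : twisted U -> twisted X -> twisted (U + X).
Proof. by move=> hU hX x; rewrite mulmxDr mulmxDl hU hX scalerDr. Qed.

Lemma twistedZ a U : twisted U -> twisted (a *: U).
Proof. by move=> hU x; rewrite -scalemxAr -scalemxAl hU !scalerA mulrC. Qed.

Lemma twistedB U X : twisted U -> twisted X -> twisted (U - X).
Proof. by move=> hU hX; rewrite -scaleN1r; apply: twistedD => //;
  apply: twistedZ. Qed.

Lemma twistedM U X : twisted U -> twisted X -> intertwines s s (U *m X).
Proof.
move=> hU hX x; rewrite mulmxA hU -scalemxAl -mulmxA hX -scalemxAr scalerA.
by rewrite chi2 scale1r mulmxA.
Qed.

Lemma twisted_mul_comm U X : twisted U -> intertwines s s X -> twisted (U *m X).
Proof. by move=> hU hX x; rewrite mulmxA hU -scalemxAl -mulmxA hX mulmxA. Qed.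

Lemma intertwines1 : intertwines s s 1%:M.
Proof. by move=> x; rewrite mulmx1 mul1mx. Qed.

Lemma chi_cases x : chi x = 1 \/ chi x = -1.
Proof.
have /eqP := chi2 x; rewrite -expr2 sqrf_eq1 => /orP[/eqP|/eqP];
  by [left|right].
Qed.

Lemma chi_exN1 : exists x, chi x = -1.
Proof. by have [x /eqP xN] := chiN1; exists x; case: (chi_cases x). Qed.

(** Conjugating U by an element on which chi is -1 changes its sign. *)
Lemma mxtrace_twisted U : twisted U -> \tr U = 0.
Proof.
move=> hU; have [x ex] := chi_exN1.
have : \tr (s x *m U *m (s x)^T) = - \tr U.
  by rewrite hU ex scaleN1r mulNmx -mulmxA orth_repMt // mulmx1 linearN.
rewrite mxtrace_mulC mulmxA (proj2 hs) mul1mx => /eqP.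
by rewrite -addr_eq0 -mulr2n mulrn_eq0 => /eqP.
Qed.

(** The vector w that represents v |-> tr (v U) on E satisfies g w = chi w. *)
Lemma twisted_orth_octL U v : twisted U -> \tr (octL v *m U) = 0.
Proof.
move=> hU; pose w : 'cV[R]_7 := \col_i \tr (octL (delta_mx i 0) *m U).
have trE u : \tr (octL u *m U) = dotv u w.
  rewrite dotvE {1}/octL mulmx_suml linear_sum; apply: eq_bigr => i _.
  by rewrite -scalemxAl linearZ /= mxE oct_unitE.
have step x u : dotv (g x *m u) w = chi x * dotv u w.
  have Us : U *m s x = chi x *: (s x *m U) by rewrite hU scalerA chi2 scale1r.
  rewrite -!trE; have -> : octL (g x *m u) *m U =
      octL (g x *m u) *m U *m s x *m (s x)^T.
    by rewrite -mulmxA orth_repMt // mulmx1.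
  rewrite mxtrace_mulC -(mulmxA _ U) Us -2!scalemxAr linearZ /=; congr (_ * _).
  by rewrite (mulmxA _ (s x)) -sJ !mulmxA (proj2 hs) mul1mx.
have gw x : g x *m w = chi x *: w.
  have gtw : (g x)^T *m w = chi x *: w.
    apply/colP => i; have := step x (delta_mx i 0).
    by rewrite dotv_mulmx -dotvZr !dotv_deltal.
  have : g x *m ((g x)^T *m w) = chi x *: (g x *m w) by rewrite gtw -scalemxAr.
  by rewrite mulmxA orth_repMt // mul1mx => {2}->; rewrite scalerA chi2 scale1r.
rewrite trE; have [->|w0] := eqVneq w 0;
  first by rewrite dotvE big1 // => i _; rewrite mxE mulr0.
by case: (no_line w0) => x; exists (chi x).
Qed.

Lemma twisted_bivector U : twisted U -> U^T = - U -> bivector U.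
Proof. by move=> hU Ut; split=> // v; apply: twisted_orth_octL. Qed.

(** The action of x turns a vector commuting with X into one commuting with
    the transform Y of X. *)
Lemma comm_transport x v X Y : s x *m X = Y *m s x ->
  octL v *m X = X *m octL v ->
  octL (g x *m v) *m Y = Y *m octL (g x *m v).
Proof.
move=> hX vX; apply: (@spinor_action_inj x).
rewrite -(mulmxA _ Y) -hX mulmxA -sJ -(mulmxA _ _ X) vX mulmxA hX.
by rewrite -!mulmxA sJ.
Qed.

Lemma no_stable_plane P : orth_proj P -> intertwines s s P -> \tr P != 2%:R.
Proof.
move=> pP hP; apply/eqP => /(orth_proj_plane_line pP)[v [v0 vP uniq_v]].
by apply: (no_line v0) => x; apply: uniq_v; apply: comm_transport vP.
Qed.

(** The vectors that anticommute with U form a nonzero stable subspace; as it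
    is not a line, it contains two orthonormal vectors, and
    [quadrivector_decomposable] applies.  The sign c covers both matrices
    that commute with the action and twisted ones. *)
Lemma involution_decomposable U : U^T = U -> U *m U = 1%:M -> \tr U = 0 ->
  (forall x, exists2 c, c * c = 1 & s x *m U = c *: (U *m s x)) ->
  exists l : seq 'cV[R]_7,
    [/\ ~~ odd (size l), all [pred u | dotv u u == 1] l & U = \prod_(u <- l)
      octL u].
Proof.
move=> Ut UU trU hU; have [v1 v10 v1U] := exists_anticommuting Ut UU trU.
have antiZ a u : anticomm_by U u -> anticomm_by U (a *: u).
  by move=> uU; rewrite /anticomm_by linearZ /= -scalemxAl uU -scalemxAr
    scalerN.
have antiB u w : anticomm_by U u -> anticomm_by U w -> anticomm_by U (u - w).
  by move=> uU wU; rewrite /anticomm_by linearB /= mulmxBl mulmxBr uU wU opprB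
    addrC opprK.
have [c c0 v_unit] := normalize v10; set v := c *: v1 in v_unit.
have vU : anticomm_by U v := antiZ c v1 v1U.
have v0 : v != 0 by rewrite scaler_eq0 negb_or c0.
have [x nx] : exists x, ~ exists a, g x *m v = a *: v.
  by apply: contrapT => h; apply: (no_line v0) => x; apply: contrapT => nx;
    apply: h; exists x.
have gvU : anticomm_by U (g x *m v).
  have [a aa sU] := hU x; apply: (@spinor_action_inj x).
  have Us : U *m s x = a *: (s x *m U) by rewrite sU scalerA aa scale1r.
  rewrite -(mulmxA _ U) Us -scalemxAr mulmxA -sJ -(mulmxA _ _ U) vU mulmxN.
  by rewrite mulmxA sU -scalemxAl scalerN scalerA aa scale1r mulNmx -!mulmxA sJ.
(* g x v is not proportional to v; orthogonalise it against v *)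
pose w1 := g x *m v - dotv (g x *m v) v *: v.
have w10 : w1 != 0.
  by apply/eqP => /eqP; rewrite subr_eq0 => /eqP e; apply: nx; eexists;
    exact: e.
have w1v : dotv v w1 = 0.
  by rewrite /w1 dotvDr dotvNr dotvZr v_unit mulr1 dotvC subrr.
have [d d0 w_unit] := normalize w10.
have wv0 : dotv v (d *: w1) = 0 by rewrite dotvZr w1v mulr0.
have wU : anticomm_by U (d *: w1) := antiZ d _ (antiB _ _ gvU (antiZ _ _ vU)).
have [y [z [y1 z1 eU]]] :=
  quadrivector_decomposable Ut UU vU wU v_unit w_unit wv0.
exists [:: d *: w1; v; y; z]; split=> //.
  by rewrite /= w_unit v_unit y1 z1 !eqxx.
by rewrite eU !big_cons big_nil mulr1 -mulmxA.
Qed.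

(** Conjugation by a product of unit vectors preserves E. *)
Lemma octL_prod_conj (l : seq 'cV[R]_7) v : all [pred u | dotv u u == 1] l ->
  exists v', \prod_(u <- l) octL u *m octL v = octL v' *m \prod_(u <- l) octL u.
Proof.
elim: l => [|u l IHl] /=.
  by exists v; rewrite big_nil mul1mx mulmx1.
move=> /andP[/eqP u1 /IHl[w ew]]; exists ((dotv u w *+ 2) *: u - w).
rewrite big_cons -mulmxA ew !mulmxA; congr (_ *m _).
rewrite octL_swap linearB /= linearZ /= mulmxBl -scalemxAl octL_sq u1.
by rewrite addrC -raddfN scale_scalar_mx mulrN mulr1.
Qed.

(** Let v span the line of the plane P, one of the two eigenplanes of U.  The
    involution w = 2 p - 1 is a product of unit vectors, so w v w is a vector
    v'; it agrees with v on P because w is the identity there, hence v' = v.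
    So v preserves the image of p as well as P, hence also the other
    eigenplane P' = p - P, and spans the line of P' too.  The group permutes
    P and P'. *)
Lemma no_swapped_planes p U : orth_proj p -> intertwines s s p -> \tr p = 4%:R
  ->
  twisted U -> U^T = U -> U *m U = p -> U *m p = U -> p *m U = U -> False.
Proof.
move=> pp hp trp hU Ut UU Up pU; have [pt ppp] := pp.
have trU : \tr U = 0 := mxtrace_twisted hU.
have two : (2%:R : R) != 0 by rewrite pnatr_eq0.
pose P := 2%:R^-1 *: (p + U); pose P' := 2%:R^-1 *: (p - U).
have pP : orth_proj P by apply: orth_proj_half.
have pP' : orth_proj P'.
  apply: orth_proj_half; rewrite // ?linearN /= ?Ut ?mulmxN ?mulNmx ?opprK //.
    by rewrite pU.
  by rewrite Up.
have tr2 : 2%:R^-1 * 4%:R = 2%:R :> R.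
  by apply: (mulfI two); rewrite mulrA mulfV // mul1r -natrM.
have trP : \tr P = 2%:R by rewrite mxtraceZ mxtraceD trU addr0 trp.
have trP' : \tr P' = 2%:R by rewrite mxtraceZ linearB /= trU subr0 trp.
have PP' : P' = p - P.
  apply: (scalerI two); rewrite scalerBr !scalerA mulfV // !scale1r.
  by rewrite scaler_nat mulr2n opprD addrA addrK.
have [v [v0 vP uniqP]] := orth_proj_plane_line pP trP.
have [v2 [_ _ uniqP']] := orth_proj_plane_line pP' trP'.
pose w := p *+ 2 - 1%:M.
have wP : w *m P = P.
  have pPP : p *m P = P by rewrite -scalemxAr mulmxDr ppp pU.
  by rewrite mulmxBl mul1mx mulr2n mulmxDl pPP addrK.
have wt : w^T = w by rewrite linearB /= linearMn /= pt trmx1.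
have ww : w *m w = 1%:M.
  have pw : p *m w = p by rewrite mulmxBr mulmx1 mulr2n mulmxDr ppp addrK.
  rewrite {1}/w mulmxBl mul1mx mulr2n mulmxDl pw.
  by rewrite /w opprB -mulr2n addrC subrK.
have trw : \tr w = 0.
  by rewrite linearB /= linearMn /= trp mxtrace1 -mulrnA subrr.
have hw : intertwines s s w.
  by apply: intertwinesB; [rewrite mulr2n;
    apply: intertwinesD | exact: intertwines1].
have [x|l [_ lu ew]] := involution_decomposable wt ww trw.
  by exists 1; rewrite ?mulr1 // scale1r.
have [v' wv] := octL_prod_conj v lu; rewrite -ew in wv.
have ev : v' = v.
  have P0 : P != 0.
    by apply/eqP => P0; move/eqP: trP; rewrite P0 mxtrace0 eq_sym pnatr_eq0.
  have e : octL (v' - v) *m P = 0.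
    rewrite linearB mulmxBl; apply/eqP; rewrite subr_eq0; apply/eqP.
    by rewrite -{1}wP mulmxA -wv -mulmxA vP mulmxA wP.
  move: P0 => /matrix0Pn[i [j Pij]].
  have Pj : P *m delta_mx j (0 : 'I_1) != 0.
    by rewrite -colE; apply: contraNneq Pij => /colP/(_ i); rewrite !mxE => ->.
  apply/eqP; rewrite -subr_eq0; apply/eqP; apply: (octL_spinor_inj Pj).
  by rewrite mulmxA e mul0mx.
have vp : octL v *m p = p *m octL v.
  have e2 : p = 2%:R^-1 *: (w + 1%:M).
    by rewrite /w subrK -scaler_nat scalerA mulVf // scale1r.
  by rewrite e2 -scalemxAr -scalemxAl mulmxDr mulmxDl wv ev mulmx1 mul1mx.
have vP' : octL v *m P' = P' *m octL v by rewrite PP' mulmxBr mulmxBl vp vP.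
apply: (no_line v0) => x; have [cx|cx] := chi_cases x.
  apply: uniqP; apply: comm_transport vP.
  by rewrite -scalemxAr -scalemxAl mulmxDr mulmxDl hp hU cx scale1r.
have [c2 ec2] := uniqP' v vP'.
have [|c1 ->] := uniqP' (g x *m v).
  apply: comm_transport vP.
  by rewrite -scalemxAr -scalemxAl mulmxDr mulmxBl hp hU cx scaleN1r.
exists (c1 / c2); rewrite ec2 scalerA divfK //.
by apply: contraNneq v0 => c20; rewrite ec2 c20 scale0r.
Qed.

Lemma mxtrace_mul_twisted_sq N x : twisted N -> chi x * \tr (s x *m (N *m N)) =
  \tr (s x *m (N *m N)).
Proof.
move=> hN; have e : \tr (N *m s x *m N) = \tr (s x *m (N *m N)).
  by rewrite mxtrace_mulC [in RHS]mxtrace_mulC !mulmxA.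
by rewrite -[in LHS]e [in RHS]mulmxA hN -scalemxAl linearZ /=.
Qed.

Let skew N := [/\ twisted N, N^T = - N & orth_proj (- (N *m N))].

(** X and N act on orthogonal subspaces.  On an eigenspace of - X^2, a
    multiple of X has square -1, and it can be added to N. *)
Lemma extend_skew N X : skew N -> twisted X -> X^T = - X -> X *m N = 0 -> X !=
  0 ->
  exists2 N', skew N' & \tr (- (N *m N)) < \tr (- (N' *m N')).
Proof.
move=> [hN Nt [et ee]] hX Xt XN X0; set e := - _ in et ee.
have NX : N *m X = 0.
  by rewrite -[LHS]trmxK trmx_mul Xt Nt mulmxN mulNmx opprK XN trmx0.
have XX : (- (X *m X))^T = - (X *m X).
  by rewrite linearN /= trmx_mul Xt mulmxN mulNmx opprK.
have XX0 : - (X *m X) != 0.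
  apply: contraNneq X0 => h; apply/eqP/trmx_inj; rewrite trmx0.
  by apply: mul_mx_tr_eq0; rewrite trmxK Xt mulNmx h.
have [l [E [l0 E0 pE AE cE]]] := spectral_projection XX XX0.
have [Et EE] := pE.
have hE : intertwines s s E.
  by move=> x; apply: cE; rewrite mulmxN mulNmx (twistedM hX hX).
have XE : X *m E = E *m X by apply: cE; rewrite mulmxN mulNmx mulmxA.
have EN : E *m N = 0.
  apply: (scalerI l0); rewrite scaler0 scalemxAl -AE.
  have NE : N *m E = E *m N.
    by apply: cE; rewrite mulmxN mulNmx mulmxA NX -mulmxA XN mulmx0 mul0mx.
  by rewrite -mulmxA -NE mulmxA mulNmx -mulmxA XN mulmx0 oppr0 mul0mx.
have NE : N *m E = 0.
  by rewrite -[LHS]trmxK trmx_mul Nt Et mulmxN EN oppr0 trmx0.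
have trE : 0 < \tr E.
  rewrite lt_def; apply/andP; split.
    by apply: contraNneq E0 => /(orth_proj_tr_eq0 pE)/eqP.
  by rewrite -EE -{2}Et mxtrace_mul_tr_ge0.
have l_gt0 : 0 < l.
  rewrite lt_def l0 /= -(pmulr_lge0 _ trE).
  have -> : l * \tr E = \tr ((X *m E) *m (X *m E)^T).
    rewrite trmx_mul Et Xt !mulmxN mulmxA -(mulmxA X) EE XE -mulmxA.
    by rewrite -mulmxN mxtrace_mulC AE linearZ.
  exact: mxtrace_mul_tr_ge0.
pose a := (Num.sqrt l)^-1.
have aa : a * a * l = 1 by rewrite -invfM -expr2 sqr_sqrtr ?ltW // mulVf.
pose W := a *: (X *m E).
have WW : W *m W = - E.
  rewrite /W -scalemxAl -scalemxAr scalerA {2}XE !mulmxA -(mulmxA X) EE.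
  rewrite -mulmxA -XE mulmxA -[X *m X]opprK mulNmx AE scalerN scalerA aa.
  by rewrite scale1r.
have WN : W *m N = 0 by rewrite /W -scalemxAl -mulmxA EN mulmx0 scaler0.
have NW : N *m W = 0 by rewrite /W -scalemxAr mulmxA NX mul0mx scaler0.
have eV : - ((N + W) *m (N + W)) = e + E.
  by rewrite mulmxDl !mulmxDr WN NW WW addr0 add0r opprD opprK.
have eE : e *m E = 0 by rewrite /e mulNmx -mulmxA NE mulmx0 oppr0.
have Ee : E *m e = 0 by rewrite /e mulmxN mulmxA EN mul0mx oppr0.
exists (N + W); last by rewrite eV linearD /= ltrDl.
split.
- by apply: twistedD => //; apply: twistedZ; apply: twisted_mul_comm.
- rewrite linearD /= Nt /W linearZ /= trmx_mul Et Xt mulmxN -XE.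
  by rewrite scalerN opprD.
rewrite eV; split; first by rewrite linearD /= et Et.
by rewrite mulmxDl !mulmxDr eE Ee ee EE addr0 add0r.
Qed.

Lemma maximal_skew : exists2 N, skew N &
  forall X, twisted X -> X^T = - X -> X *m N = 0 -> X = 0.
Proof.
pose ok m := `[< exists2 N, skew N & \rank (- (N *m N)) = m >].
have ok0 : exists m, ok m.
  exists 0%N; apply/asboolP; exists 0; last by rewrite mulmx0 oppr0 mxrank0.
  split; first by move=> x; rewrite mulmx0 mul0mx scaler0.
    by rewrite trmx0 oppr0.
  by rewrite mulmx0 oppr0; split; rewrite ?trmx0 ?mulmx0.
have okb m : ok m -> (m <= 8)%N.
  by move=> /asboolP[N _ <-]; exact: rank_leq_col.
case: (ex_maxnP ok0 okb) => m /asboolP[N sN rN] mmax; exists N => // X hX Xt XN.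
apply/eqP/negPn/negP => /(extend_skew sN hX Xt XN)[N' sN'].
have [_ _ [_ ee]] := sN; have [_ _ [_ ee']] := sN'.
rewrite !mxtrace_idem // ltr_nat rN ltnNge => /negP; apply; apply: mmax.
by apply/asboolP; exists N'.
Qed.

(** U is a twisted isometry of the image of p = 1 - e, where e = - N^2 is of
    largest rank; the eigenvalues 1 and -1 of U have the same multiplicity k,
    and the five possible values of k are treated in turn. *)
Lemma twisted_product : exists l : seq 'cV[R]_7,
  [/\ ~~ odd (size l), all [pred u | dotv u u == 1] l
    & forall x, s x *m \prod_(u <- l) octL u =
                chi x *: (\prod_(u <- l) octL u *m s x)].
Proof.
have [N [hN Nt pe] Nmax] := maximal_skew.
pose e := - (N *m N); have [et ee] := pe; rewrite -/e in pe et ee.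
have he : intertwines s s e by move=> x;
  rewrite /e mulmxN mulNmx (twistedM hN hN).
pose p := 1%:M - e.
have pp : orth_proj p.
  by apply: orth_projB => //; [split;
    rewrite ?trmx1 ?mulmx1|rewrite mul1mx|rewrite mulmx1].
have hp : intertwines s s p by move=> x;
  rewrite mulmxBr mulmxBl mulmx1 mul1mx he.
(* s and chi s have the same character on S and, through N, on the image of e *)
have tr_p x : \tr (s x *m p) = \tr (chi x *: s x *m p).
  rewrite -scalemxAl linearZ /= /p mulmxBr mulmx1 linearB /= mulrBr chi_tr.
  by rewrite /e mulmxN linearN /= mulrN mxtrace_mul_twisted_sq.
have hp' : intertwines (fun x => chi x *: s x) (fun x => chi x *: s x) p.
  by move=> x; rewrite -scalemxAl -scalemxAr hp.
have [U [/intertwines_twisted hU UtU UUt]] := exists_isometry hs hchi pp pp hp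
  hp' tr_p.
have [pt ppp] := pp.
have ep : e *m p = 0 by rewrite /p mulmxBr mulmx1 ee subrr.
have pe0 : p *m e = 0 by rewrite /p mulmxBl mul1mx ee subrr.
have eU : e *m U = 0.
  by apply: mul_mx_tr_eq0;
    rewrite trmx_mul et !mulmxA -(mulmxA e) UUt ep mul0mx.
have eUt : e *m U^T = 0.
  by apply: mul_mx_tr_eq0;
    rewrite trmx_mul trmxK et !mulmxA -(mulmxA e) UtU ep mul0mx.
have pN : p *m N = 0.
  apply: mul_mx_tr_eq0; rewrite trmx_mul pt Nt mulNmx mulmxN mulmxA -(mulmxA p).
  by rewrite -mulNmx -mulmxN -/e pe0 mul0mx.
have eN : e *m N = N.
  by have := pN; rewrite /p mulmxBl mul1mx => /eqP; rewrite subr_eq0 => /eqP.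
have Ue : U *m e = 0 by rewrite -[LHS]trmxK trmx_mul et eUt trmx0.
have Ute : U^T *m e = 0 by rewrite -[LHS]trmxK trmx_mul et trmxK eU trmx0.
(* the skew part of U vanishes by maximality of N *)
have Ut : U^T = U.
  apply/esym/eqP; rewrite -subr_eq0; apply/eqP; apply: Nmax.
  - by apply: twistedB => //; apply: twisted_trmx.
  - by rewrite linearB /= trmxK opprB.
  - by rewrite mulmxBl -eN !mulmxA Ue Ute !mul0mx subrr.
have UU : U *m U = p by rewrite -{1}Ut.
have trU : \tr U = 0 := mxtrace_twisted hU.
have two : (2%:R : R) != 0 by rewrite pnatr_eq0.
have Up : U *m p = U by rewrite /p mulmxBr mulmx1 Ue subr0.
have pU : p *m U = U by rewrite /p mulmxBl mul1mx eU subr0.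
pose P := 2%:R^-1 *: (p + U).
have pP : orth_proj P by apply: orth_proj_half.
pose k := \rank P.
have trP : \tr P = k%:R by apply: mxtrace_idem; case: pP.
have tr_p2 : \tr p = (k * 2)%:R.
  rewrite natrM -trP mxtraceZ [\tr (_ + U)]mxtraceD trU addr0 mulrC mulrA.
  by rewrite mulfV ?mul1r.
have tr_e : \tr e = (8 - k * 2)%:R.
  have k8 : (k * 2 <= 8)%N.
    rewrite -(ler_nat R) -tr_p2 (mxtrace_idem ppp) ler_nat; exact: rank_leq_col.
  by rewrite natrB // -tr_p2 /p linearB /= mxtrace1 opprB addrC subrK.
have k4 : (k <= 4)%N.
  rewrite -(leq_pmul2r (isT : 0 < 2)%N) -(ler_nat R) -tr_p2 (mxtrace_idem ppp).
  rewrite ler_nat; exact: rank_leq_col.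
have fin (l : seq 'cV[R]_7) V : twisted V ->
    [/\ ~~ odd (size l), all [pred u | dotv u u == 1] l &
        V = \prod_(u <- l) octL u] ->
    exists l : seq 'cV[R]_7, [/\ ~~ odd (size l),
      all [pred u | dotv u u == 1] l
    & forall x, s x *m \prod_(u <- l) octL u =
                chi x *: (\prod_(u <- l) octL u *m s x)].
  by move=> hV [l2 lu eV]; exists l; split=> // x; rewrite -eV.
case: k k4 trP tr_p2 tr_e => [|[|[|[|[|//]]]]] _ trP tr_p2 tr_e.
- have p0 : p = 0 := orth_proj_tr_eq0 pp tr_p2.
  have NN : N *m N = - 1%:M.
    apply: oppr_inj; rewrite opprK -/e; apply/esym/eqP.
    by rewrite -subr_eq0 -/p p0.
  have [u [v [u1 v1 eNuv]]] := bivector_decomposable (twisted_bivector hN Nt)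
    NN.
  apply: (fin [:: u; v] N) => //; split=> //; first by rewrite /= u1 v1 !eqxx.
  by rewrite !big_cons big_nil mulr1.
- by have := no_stable_plane pp hp; rewrite tr_p2 eqxx.
- by case: (no_swapped_planes pp hp tr_p2 hU Ut UU Up pU).
- by have := no_stable_plane pe he; rewrite tr_e eqxx.
have e0 : e = 0 := orth_proj_tr_eq0 pe tr_e.
have UU1 : U *m U = 1%:M by rewrite UU /p e0 subr0.
have [x|l hl] := involution_decomposable Ut UU1 trU.
  by exists (chi x).
exact: fin hU hl.
Qed.
End Core.

(** * Matrix representations of Clifford algebras *)

Section CliffordRep.
Variables (R : comNzRingType) (n m : nat) (c : 'I_n -> 'M[R]_m).
Hypothesis c_sq : forall i, c i *m c i = 1%:M.
Hypothesis c_anti : forall i j, i != j -> c i *m c j = - (c j *m c i).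
Implicit Types (A B C : {set 'I_n}) (i j : 'I_n) (r : seq 'I_n).

Let fac A i : 'M[R]_m := if i \in A then c i else 1%:M.

(** The factor c i moves to its place past the factors of smaller index, with
    a sign change for each index in A, and cancels there if i was in A. *)
Lemma fac_prod_insert r i A : sorted ltn (map val r) -> i \in r ->
  c i *m \prod_(j <- r) fac A j =
  (\prod_(j <- r | (j < i)%N) (-1) ^+ (j \in A)) *:
    \prod_(j <- r) fac (symd [set i]%SET A) j.
Proof.
elim: r => [//|k r IHr] /= srt; rewrite inE => /orP[/eqP eik|ir].
  have gtk j : j \in r -> (k < j)%N.
    by move=> jr; have := order_path_min ltn_trans srt;
      move=> /allP/(_ _ (map_f _ jr)).
  rewrite !big_cons eik ltnn.
  have -> : \prod_(j <- r | (j < k)%N) (-1) ^+ (j \in A) = 1 :> R.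
    rewrite big_seq_cond big1 // => j /andP[jr].
    by rewrite ltnNge (ltnW (gtk j jr)).
  rewrite scale1r.
  have -> : \prod_(j <- r) fac (symd [set k]%SET A) j = \prod_(j <- r) fac A j.
    apply: eq_big_seq => j jr; rewrite /fac in_symd inE.
    by rewrite (_ : (j == k) = false) //; apply/negbTE;
      rewrite -val_eqE gtn_eqF // gtk.
  rewrite mulmxA; congr (_ *m _); rewrite /fac in_symd inE eqxx /=.
  by case: (k \in A); rewrite /= ?c_sq ?mulmx1.
have lt_ki : (k < i)%N.
  by have := order_path_min ltn_trans srt; move=> /allP/(_ _ (map_f _ ir)).
have nki : (k == i) = false by rewrite -val_eqE ltn_eqF.
have E (X Y : 'M[R]_m) : X * Y = X *m Y by [].
rewrite !big_cons lt_ki !E.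
have -> : fac (symd [set i]%SET A) k = fac A k by rewrite /fac in_symd inE nki.
rewrite -scalerA scalemxAr -(IHr (path_sorted srt) ir) !mulmxA scalemxAl.
congr (_ *m _); rewrite /fac; case: (k \in A) => /=.
  by rewrite expr1 scaleN1r c_anti // eq_sym nki.
by rewrite expr0 scale1r mulmx1 mul1mx.
Qed.

Lemma csign_set1l i A :
  csign R [set i]%SET A = \prod_(j < n | (j < i)%N) (-1) ^+ (j \in A).
Proof.
rewrite /csign -(pair_big_dep predT (fun k j : 'I_n => (j < k)%N)
  (fun k j => (-1) ^+ ((k \in [set i]%SET) && (j \in A)))) /=.
rewrite (bigD1 i) //= [X in _ * X]big1 ?mulr1 => [|k nk].
  by apply: eq_bigr => j _; rewrite inE eqxx.
by apply: big1 => j _; rewrite inE (negPf nk).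
Qed.

Definition cliff_monomial A : 'M[R]_m := \prod_(j < n) fac A j.

Lemma cliff_monomial_insert i A :
  c i *m cliff_monomial A = csign R [set i]%SET A *: cliff_monomial (symd [set
    i]%SET A).
Proof.
rewrite /cliff_monomial fac_prod_insert ?csign_set1l ?mem_index_enum //.
by rewrite -[index_enum _]enumT val_enum_ord iota_ltn_sorted.
Qed.

Lemma cliff_monomial0 : cliff_monomial finset.set0 = 1%:M.
Proof. by apply: big1 => i _; rewrite /fac inE. Qed.

Lemma cliff_monomialM A B : cliff_monomial A *m cliff_monomial B =
  csign R A B *: cliff_monomial (symd A B).
Proof.
have [k] := ubnP #|A|; elim: k A => // k IHk A ltA.
have [->|[i iA]] := set_0Vmem A.
  by rewrite cliff_monomial0 mul1mx csign0l scale1r sym0d.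
pose A' := (A :\ i)%SET.
have eA : symd [set i]%SET A' = A.
  by apply/setP => j; rewrite in_symd !inE; case: eqP => [->|].
have eM : cliff_monomial A = csign R [set i]%SET A' *: (c i *m cliff_monomial
  A').
  by rewrite cliff_monomial_insert eA scalerA csign_sq scale1r.
have ltA' : (#|A'| < k)%N.
  by move: ltA; rewrite (cardsD1 i) iA add1n ltnS.
rewrite eM -scalemxAl -mulmxA IHk // -scalemxAr cliff_monomial_insert !scalerA
  symdA eA.
congr (_ *: _); rewrite -[in RHS]eA csignDl csignDr.
transitivity (csign R [set i]%SET A' * csign R [set i]%SET A' *
  (csign R A' B * csign R [set i]%SET B)); first by ring.
by rewrite csign_sq; ring.
Qed.

Definition cliff_rep (x : cliff R n) : 'M[R]_m := \sum_A x A *: cliff_monomial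
  A.

Lemma cliff_rep_is_linear : linear cliff_rep.
Proof.
move=> a x y; rewrite /cliff_rep scaler_sumr -big_split /=.
by apply: eq_bigr => A _; rewrite scalerA -scalerDl !ffunE.
Qed.

HB.instance Definition _ :=
  GRing.isLinear.Build R (cliff R n) 'M[R]_m _ cliff_rep cliff_rep_is_linear.

(** Matrices c i with square 1 that anticommute extend to a representation of
    the Clifford algebra. *)
Lemma cliff_repM x y : cliff_rep (x * y) = cliff_rep x *m cliff_rep y.
Proof.
rewrite /cliff_rep mulmx_suml.
transitivity (\sum_A \sum_B (csign R B (symd B A) * (x B * y (symd B A))) *:
  cliff_monomial A).
  by apply: eq_bigr => A _; rewrite cmulE scaler_suml.
rewrite exchange_big /=; apply: eq_bigr => B _; rewrite mulmx_sumr.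
rewrite (reindex_inj (can_inj (symdK B))) /=; apply: eq_bigr => C _.
rewrite symdK -scalemxAl -scalemxAr scalerA cliff_monomialM !scalerA.
by congr (_ *: _); rewrite mulrC.
Qed.

Lemma cliff_rep1 : cliff_rep 1 = 1%:M.
Proof.
rewrite /cliff_rep (bigD1 finset.set0) //= big1 => [|A nA].
  by rewrite ffunE eqxx scale1r addr0 cliff_monomial0.
by rewrite ffunE (negPf nA) scale0r.
Qed.

Lemma cliff_rep_cvec v : cliff_rep (cvec v) = \sum_i v i 0 *: c i.
Proof.
rewrite /cvec linear_sum; apply: eq_bigr => i _; rewrite linearZ /=;
  congr (_ *: _).
rewrite /cliff_rep (bigD1 [set i]%SET) //= big1 => [|A nA]; last first.
  by rewrite ffunE (negPf nA) scale0r.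
rewrite ffunE eqxx scale1r addr0 -[RHS]mulmx1 -cliff_monomial0.
by rewrite cliff_monomial_insert csign0r scale1r symd0.
Qed.

End CliffordRep.

(** * The spin representation *)

Section SpinRep.
Variable R : realType.
Implicit Types (u v : 'cV[R]_7) (l : seq 'cV[R]_7) (x y : cliff R 7).

(** The vectors of the Clifford algebra have square |v|^2, whereas those of
    [octL] have square - |v|^2.  Two copies of the spinors correct the sign;
    a product of two blocks is diagonal, with the product of the entries up
    to sign. *)
Definition oct_block (D : 'M[R]_8) : 'M[R]_(8 + 8) := block_mx 0 (- D) D 0.

Lemma oct_block_is_linear : linear oct_block.
Proof.
move=> a D D'; rewrite /oct_block scale_block_mx add_block_mx !scaler0 !addr0.
by rewrite opprD scalerN.
Qed.

HB.instance Definition _ :=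
  GRing.isLinear.Build R 'M[R]_8 'M[R]_(8 + 8) _ oct_block oct_block_is_linear.

Lemma oct_blockM D D' : oct_block D *m oct_block D' =
  block_mx (- (D *m D')) 0 0 (- (D *m D')).
Proof.
by rewrite /oct_block mulmx_block !mul0mx !mulmx0 !addr0 !add0r mulNmx mulmxN.
Qed.

Lemma oct_block_unit_sq i : oct_block (oct_unit R i) *m oct_block (oct_unit R
  i) = 1%:M.
Proof.
rewrite oct_blockM !oct_unitE octL_sq dotv_deltal mxE !eqxx.
by rewrite raddfN opprK -scalar_mx_block.
Qed.

Lemma oct_block_unit_anti i j : i != j ->
  oct_block (oct_unit R i) *m oct_block (oct_unit R j) =
  - (oct_block (oct_unit R j) *m oct_block (oct_unit R i)).
Proof.
move=> nij; rewrite !oct_blockM !oct_unitE octL_swap dotv_deltal mxE (negPf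
  nij).
by rewrite mul0rn raddf0 subr0 opp_block_mx oppr0.
Qed.

Definition pin_rep : cliff R 7 -> 'M[R]_(8 + 8) :=
  cliff_rep (fun i => oct_block (oct_unit R i)).

Lemma pin_repM x y : pin_rep (x * y) = pin_rep x *m pin_rep y.
Proof. exact: (cliff_repM oct_block_unit_sq oct_block_unit_anti). Qed.

Lemma pin_repZ a x : pin_rep (a *: x) = a *: pin_rep x.
Proof. by rewrite /pin_rep linearZ. Qed.

Lemma pin_rep1 : pin_rep 1 = 1%:M.
Proof. exact: cliff_rep1. Qed.

Lemma pin_rep_cvec v : pin_rep (cvec v) = oct_block (octL v).
Proof.
rewrite /pin_rep (cliff_rep_cvec oct_block_unit_sq oct_block_unit_anti).
rewrite /octL linear_sum; apply: eq_bigr => i _.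
by rewrite linearZ.
Qed.

(** Each pair of vectors contributes a sign, collected in e. *)
Lemma pin_rep_prod l : exists2 e : R, e * e = 1 &
  pin_rep (\prod_(u <- l) cvec u) =
  if odd (size l) then oct_block (e *: \prod_(u <- l) octL u)
  else block_mx (e *: \prod_(u <- l) octL u) 0 0 (e *: \prod_(u <- l) octL u).
Proof.
elim: l => [|u l [e ee IHl]].
  exists 1; rewrite ?mulr1 // !big_nil pin_rep1 scale1r.
  exact: scalar_mx_block.
have [odd_l|even_l] := boolP (odd (size l)).
  exists (- e); first by rewrite mulrNN.
  rewrite !big_cons pin_repM IHl odd_l pin_rep_cvec oct_blockM /= odd_l.
  by rewrite scaleNr -scalemxAr.
exists e => //; rewrite !big_cons pin_repM IHl (negPf even_l) pin_rep_cvec /=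
  even_l.
rewrite /oct_block mulmx_block !mul0mx !mulmx0 !addr0 !add0r mulNmx.
by rewrite -!scalemxAr.
Qed.

(** On the even part, [pin_rep] is twice the spin representation. *)
Definition spin_rep x : 'M[R]_8 := ulsubmx (pin_rep x).

Lemma is_spin_list x : is_spin x -> exists l (e : R),
  [/\ all [pred u | dotv u u == 1] l, e * e = 1, x = \prod_(u <- l) cvec u,
   spin_rep x = e *: \prod_(u <- l) octL u
   & pin_rep x = block_mx (spin_rep x) 0 0 (spin_rep x)].
Proof.
move=> [l /andP[even_l ul] ->]; have [e ee] := pin_rep_prod l.
rewrite (negPf even_l) => el; exists l, e.
by rewrite /spin_rep el block_mxKul.
Qed.

Lemma pin_rep_spin x : is_spin x ->
  pin_rep x = block_mx (spin_rep x) 0 0 (spin_rep x).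
Proof. by move=> /is_spin_list[l [e []]]. Qed.

Lemma spin_repM x y : is_spin x -> is_spin y ->
  spin_rep (x * y) = spin_rep x *m spin_rep y.
Proof.
move=> sx sy; rewrite {1}/spin_rep pin_repM !pin_rep_spin // mulmx_block.
by rewrite block_mxKul mul0mx addr0.
Qed.

Lemma spin_repZ a x : spin_rep (a *: x) = a *: spin_rep x.
Proof. by rewrite /spin_rep pin_repZ; apply/matrixP => i j; rewrite !mxE. Qed.

Lemma octL_prod_orth l : all [pred u | dotv u u == 1] l ->
  (\prod_(u <- l) octL u)^T *m \prod_(u <- l) octL u = 1%:M.
Proof.
elim: l => [|u l IHl] /=; first by rewrite big_nil trmx1 mulmx1.
move=> /andP[/eqP u1 /IHl e]; rewrite big_cons trmx_mul octL_tr.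
rewrite -mulmxA (mulmxA (- octL u)) mulNmx octL_sq u1 raddfN opprK.
by rewrite mul1mx.
Qed.

Lemma spin_rep_orth x : is_spin x -> (spin_rep x)^T *m spin_rep x = 1%:M.
Proof.
move=> /is_spin_list[l [e [ul ee _ -> _]]].
have := octL_prod_orth ul; move: (\prod_(u <- l) octL u) => Q QQ.
have -> : (e *: Q)^T = e *: Q^T by rewrite linearZ.
by rewrite -scalemxAl -scalemxAr scalerA ee scale1r.
Qed.

Lemma spin_rep_octL x v : is_spin x ->
  spin_rep x *m octL v = octL (spin_mx x *m v) *m spin_rep x.
Proof.
move=> sx; have : pin_rep (x * cvec v) = pin_rep (cvec (spin_mx x *m v) * x).
  by rewrite cvec_spin_mx // -mulrA is_spin_crev_mul // mulr1.
rewrite !pin_repM !pin_rep_cvec pin_rep_spin // !mulmx_block.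
by move=> /eq_block_mx[_ _]; rewrite !mul0mx !addr0 !add0r => ->.
Qed.

End SpinRep.

(** * The kernel and the image of the double cover *)

Section SpinKernel.
Variables (R : realType) (n : nat).
Implicit Types (A B : {set 'I_n}) (i j : 'I_n) (x y z : cliff R n).

Lemma csign_set1r i A :
  csign R A [set i]%SET = \prod_(j < n | (i < j)%N) (-1) ^+ (j \in A).
Proof.
rewrite /csign -(pair_big_dep predT (fun k j : 'I_n => (j < k)%N)
  (fun k j => (-1) ^+ ((k \in A) && (j \in [set i]%SET)))) /=.
rewrite (exchange_big_dep xpredT) //= (bigD1 i) //= [X in _ * X]big1 ?mulr1 =>
  [|k nk].
  by apply: eq_bigr => j _; rewrite inE eqxx andbT.
by apply: big1 => j _; rewrite inE (negPf nk) andbF.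
Qed.

(** The vectors e_i and the basis elements e_A commute up to a sign change
    for each index of A other than i. *)
Lemma csign_set1C i A :
  csign R [set i]%SET A = (-1) ^+ #|(A :\ i)%SET| * csign R A [set i]%SET.
Proof.
have e : csign R [set i]%SET A * csign R A [set i]%SET = (-1) ^+ #|(A :\
  i)%SET|.
  have -> : #|(A :\ i)%SET| = (\sum_(j < n | j != i) (j \in A))%N.
    rewrite -sum1_card big_mkcond [RHS]big_mkcond /=; apply: eq_bigr => j _.
    by rewrite !inE; case: (j == i); case: (j \in A).
  rewrite -prodrXr [RHS](bigID (fun j : 'I_n => (j < i)%N)) csign_set1l
    csign_set1r.
  congr (_ * _); apply: eq_bigl => j; rewrite -val_eqE /=;
    first by case: ltngtP.
  by case: ltngtP.
by rewrite -e -mulrA csign_sq mulr1.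
Qed.

Lemma cvec_delta i : cvec (delta_mx i 0 : 'cV[R]_n) = cbase R [set i]%SET.
Proof.
rewrite /cvec (bigD1 i) //= big1 => [|j nj];
  first by rewrite mxE !eqxx scale1r addr0.
by rewrite mxE (negPf nj) scale0r.
Qed.

Lemma cbase_mull x A B : (cbase R A * x) B = csign R A (symd A B) * x (symd A
  B).
Proof.
rewrite cmulE (bigD1 A) //= big1 => [|C nC];
  first by rewrite ffunE eqxx mul1r addr0.
by rewrite ffunE (negPf nC) mul0r mulr0.
Qed.

Lemma cbase_mulr x A B : (x * cbase R A) B = csign R (symd B A) A * x (symd B
  A).
Proof.
have e : symd (symd B A) B = A by rewrite symdC symdK.
rewrite cmulE (bigD1 (symd B A)) //= big1 => [|C nC].
  by rewrite e ffunE eqxx mulr1 addr0.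
rewrite ffunE (_ : _ == _ = false) ?mulr0 //; apply/negbTE.
by apply: contraNneq nC => <-; rewrite (symdC C) symdK.
Qed.

Lemma odd_card_symd1 i A : odd #|symd [set i]%SET A| = ~~ odd #|A|.
Proof.
have [iA|niA] := boolP (i \in A).
  have -> : symd [set i]%SET A = (A :\ i)%SET.
    by apply/setP => j; rewrite in_symd !inE; case: eqP => [->|]; rewrite ?iA.
  by rewrite (cardsD1 i A) iA /= negbK.
have -> : symd [set i]%SET A = (i |: A)%SET.
  by apply/setP => j; rewrite in_symd !inE; case: eqP => [->|];
    rewrite ?(negPf niA).
by rewrite cardsU1 niA.
Qed.

(** The Clifford algebra is graded by parity. *)
Lemma prod_cvec_parity (l : seq 'cV[R]_n) A : odd #|A| != odd (size l) ->
  (\prod_(u <- l) cvec u) A = 0.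
Proof.
elim: l A => [|u l IHl] A.
  by rewrite big_nil ffunE; case: (A =P _) => [->|//]; rewrite cards0.
move=> oA; rewrite big_cons /cvec mulr_suml sum_ffunE big1 // => i _.
rewrite -scalerAl cscaleE cbase_mull IHl ?mulr0 // odd_card_symd1.
by move: oA => /=; case: (odd _); case: (odd _).
Qed.

(** Such a z commutes with all vectors.  If z had a coordinate at a nonempty
    A, of even size by parity, an e_i with i in A would anticommute with e_A;
    so z is a scalar, of square 1. *)
Lemma spin_kernel z : is_spin z -> spin_mx z = 1%:M -> z = 1 \/ z = - 1.
Proof.
move=> sz z1.
have comm v : z * cvec v = cvec v * z.
  by rewrite -[in RHS](mul1mx v) -z1 cvec_spin_mx // -mulrA is_spin_crev_mul //
    mulr1.
have z0 A : A != finset.set0 -> z A = 0.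
  have [oA _|eA] := boolP (odd #|A|).
    have [l /andP[el _] ->] := sz; apply: prod_cvec_parity.
    by rewrite oA (negPf el).
  move=> /set0Pn[i iA]; have := comm (delta_mx i 0).
  rewrite cvec_delta => /ffunP/(_ (symd [set i]%SET A)).
  rewrite cbase_mulr cbase_mull symdK (symdC [set i]%SET) symdKr csign_set1C.
  have oA : odd #|(A :\ i)%SET| by move: eA; rewrite (cardsD1 i A) iA /= negbK.
  rewrite -signr_odd oA expr1 mulN1r mulNr => /eqP.
  rewrite -addr_eq0 -mulr2n mulrn_eq0 /= mulf_eq0 => /orP[/eqP c0|/eqP//].
  have := csign_sq R A [set i]%SET; rewrite c0 mul0r => /eqP.
  by rewrite eq_sym oner_eq0.
have [a ez] : exists a, z = a *: 1.
  exists (z finset.set0); apply/ffunP => A; rewrite cscaleE ffunE.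
  by have [->|/z0->] := eqVneq A finset.set0; rewrite ?mulr1 ?mulr0.
have aa : a * a = 1.
  have := is_spin_mul_crev sz; rewrite ez.
  have -> : crev (a *: 1 : cliff R n) = a *: 1.
    by rewrite -[in RHS](crev1 R n); apply/ffunP => A; rewrite !ffunE mulrCA.
  rewrite -scalerAl mul1r scalerA => /ffunP/(_ finset.set0).
  by rewrite cscaleE !ffunE eqxx mulr1.
have /eqP := aa; rewrite -expr2 sqrf_eq1 ez => /orP[/eqP->|/eqP->].
  by left; rewrite scale1r.
by right; rewrite scaleN1r.
Qed.

End SpinKernel.

Section CartanDieudonne.
Variables (R : realType) (n : nat).
Implicit Types (A : 'M[R]_n) (u v x y : 'cV[R]_n).

(** The reflection in the hyperplane orthogonal to a unit vector u; it is the
    opposite of [spin_reflection], so that fixed vectors can be accumulated. *)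
Definition reflection u : 'M[R]_n := 1%:M - (u *m u^T) *+ 2.

Lemma reflectionE u v : reflection u *m v = v - (dotv u v *+ 2) *: u.
Proof.
have -> : reflection u = - spin_reflection u by rewrite opprB.
by rewrite mulNmx spin_reflectionE opprB.
Qed.

Lemma reflectionN u : reflection u = - spin_reflection u.
Proof. by rewrite opprB. Qed.

Lemma reflectionK u : dotv u u = 1 -> reflection u *m reflection u = 1%:M.
Proof.
move=> u1; have e : (spin_reflection u)^T = spin_reflection u.
  by rewrite linearB /= linearMn /= trmx_mul trmxK trmx1.
by rewrite reflectionN mulNmx mulmxN opprK -{1}e spin_reflection_orth.
Qed.

Lemma reflection_tr u : (reflection u)^T = reflection u.
Proof. by rewrite linearB /= linearMn /= trmx_mul trmxK trmx1. Qed.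

Lemma reflection_swap x y : dotv x x = dotv y y -> x != y ->
  exists2 u, dotv u u = 1 & reflection u *m x = y /\
    forall z, dotv x z = dotv y z -> reflection u *m z = z.
Proof.
move=> xy nxy; have w0 : x - y != 0 by rewrite subr_eq0.
have [c c0 u1] := normalize w0; exists (c *: (x - y)) => //; split; last first.
  move=> z xz; rewrite reflectionE dotvZl dotvBl xz subrr.
  by rewrite mulr0 mul0rn scale0r subr0.
have e : dotv (x - y) (x - y) = dotv (x - y) x *+ 2.
  by rewrite !dotvBl !(dotvDr, dotvNr) (dotvC y x) -xy; ring.
rewrite dotvZl dotvZr mulrA e in u1.
rewrite reflectionE dotvZl scalerA -mulrnAr mulrAC u1 scale1r.
by rewrite opprB addrC subrK.
Qed.

(** Cartan and Dieudonne: a reflection brings A e_k back to e_k and keeps the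
    previous basis vectors, which A already fixes. *)
Lemma orth_product_reflections A : A^T *m A = 1%:M ->
  exists2 l : seq 'cV[R]_n, all (@unit_vec R n) l &
    A = \prod_(u <- l) reflection u.
Proof.
move=> AtA.
(* d counts the basis vectors, at the end, that may still move *)
suff H d A' : (d <= n)%N -> A'^T *m A' = 1%:M ->
    (forall j : 'I_n, (j < n - d)%N -> A' *m delta_mx j 0 = delta_mx j 0 :>
      'cV_n) ->
    exists2 l : seq 'cV[R]_n, all (@unit_vec R n) l &
      A' = \prod_(u <- l) reflection u.
  by apply: (H n) => // j; rewrite subnn.
elim: d A' => [|d IHd] B dn BtB fixB.
  exists [::] => //; rewrite big_nil; apply/matrixP => i j.
  have jn : (j < n - 0)%N by rewrite subn0.
  by have /colP/(_ i) := fixB j jn; rewrite -colE !mxE eqxx andbT.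
have kn : (n - d.+1 < n)%N by rewrite ltn_subrL (leq_ltn_trans _ dn).
pose k := Ordinal kn.
have next (j : 'I_n) : (j < n - d)%N -> j = k \/ (j < n - d.+1)%N.
  rewrite -(subnSK dn) ltnS leq_eqVlt => /orP[/eqP e|]; last by right.
  by left; apply: val_inj.
have dotB x y : dotv (B *m x) (B *m y) = dotv x y.
  by rewrite dotv_mulmx mulmxA BtB mul1mx.
have [Bk|nBk] := eqVneq (B *m delta_mx k 0) (delta_mx k 0 : 'cV_n).
  by apply: IHd => // [|j /next[->//|]]; [exact: ltnW|exact: fixB].
have [u u1 [uk ufix]] := reflection_swap (dotB _ _) nBk.
have [||j /next jP|l lu el] := IHd (reflection u *m B).
- exact: ltnW.
- rewrite trmx_mul reflection_tr -mulmxA (mulmxA (reflection u)).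
  by rewrite reflectionK // mul1mx.
- rewrite -mulmxA; case: jP => [->//|jk]; rewrite fixB // ufix //.
  by rewrite -{1}(fixB j jk) dotB.
exists (u :: l); first by rewrite /= lu /unit_vec /= u1 eqxx.
by rewrite big_cons -el -[RHS]/(_ *m (_ *m _)) mulmxA reflectionK // mul1mx.
Qed.

(** The determinant makes the number of reflections even, so their signs
    relative to [spin_reflection] cancel. *)
Lemma SO_lift (A : SO R n) : exists z : spin R n, spin_pi z = A.
Proof.
have [l lu el] := orth_product_reflections (so_tr_mul A).
have even_l : ~~ odd (size l).
  have := so_det A; rewrite el.
  have -> : \det (\prod_(u <- l) reflection u) = (-1) ^+ size l.
    elim: l lu {el} => [|u l IHl] /=; first by rewrite big_nil det1.
    move=> /andP[/eqP u1 lu]; rewrite big_cons det_mulmx IHl // exprS.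
    congr (_ * _); rewrite reflectionN -scaleN1r detZ det_spin_reflection //.
    by rewrite mulrN -signr_odd -expr2 sqrr_sign.
  rewrite -signr_odd; case: (odd _) => // /eqP; rewrite expr1.
  by rewrite eq_sym -addr_eq0 -(natrD _ 1 1) pnatr_eq0.
have sz : is_spin (\prod_(u <- l) cvec u) by exists l; rewrite ?even_l.
exists (MkSpin (asboolT sz)); apply: val_inj => /=.
rewrite spin_mx_prod // el.
have -> : \prod_(u <- l) reflection u =
    (-1) ^+ size l *: foldr (fun u B => spin_reflection u *m B) 1%:M l.
  elim: l {lu el even_l sz} => [|u l IHl] /=; first by rewrite big_nil scale1r.
  rewrite big_cons IHl reflectionN exprS mulN1r scaleNr.
  by rewrite -[LHS]scalemxAr mulNmx scalerN.
by rewrite -signr_odd (negPf even_l) scale1r.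
Qed.

End CartanDieudonne.

(** * Unacceptable morphisms *)

Section Unacceptable.
Variables (R : realType) (Gamma : groupType).
Implicit Types (x y z : spin R 7) (r : {multiplicative Gamma -> spin R 7}).

Lemma spin_valM x y : spin_val (x * y)%g = spin_val x * spin_val y.
Proof. by []. Qed.

Lemma spin_pi_mxM x y :
  spin_pi (x * y)%g = spin_pi x *m spin_pi y :> 'M[R]_7.
Proof. by rewrite spin_pi_is_multiplicative. Qed.

Lemma spin_pi_orth_rep r : orth_rep (fun g => spin_pi (r g) : 'M[R]_7).
Proof.
split=> [g h|g]; last exact: so_tr_mul.
by rewrite gmulfM spin_pi_mxM.
Qed.

Lemma spin_rep_orth_rep r : orth_rep (fun g => spin_rep (r g)).
Proof.
split=> [g h|g]; last by apply: spin_rep_orth; apply: spinP.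
by rewrite gmulfM spin_repM //; exact: spinP.
Qed.

(** Elements with the same action on the spinors act in the same way on E, so
    they differ by a sign by [spin_kernel], and -1 acts as -1 on the spinors. *)
Lemma spin_rep_val_inj x y : spin_rep x = spin_rep y -> x = y.
Proof.
move=> exy; have [sx sy] := (spinP x, spinP y).
have pxy (v : 'cV[R]_7) : spin_mx x *m v = spin_mx y *m v.
  apply/eqP; rewrite -subr_eq0; apply/eqP; apply: octL_inj0; rewrite linearB /=.
  have yt := mulmx1C (spin_rep_orth sy).
  have := spin_rep_octL v sy; rewrite -exy spin_rep_octL // exy => e.
  rewrite -[octL _]mulmx1 -[X in _ - X]mulmx1 -yt !mulmxA e.
  by rewrite subrr.
have k1 : spin_mx (x * y^-1)%g = 1%:M.
  have := spin_pi_mxM (x * y^-1)%g y; rewrite mulgKV /= => e.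
  have exy' : spin_mx x = spin_mx y.
    by apply/matrixP => i j; have /matrixP/(_ i 0) := pxy (delta_mx j 0);
      rewrite -!colE !mxE.
  have yy : (spin_mx y) *m (spin_mx y)^T = 1%:M := so_mul_tr (spin_pi y).
  have := congr1 (mulmx^~ (spin_mx y)^T) e.
  by rewrite /= -mulmxA yy mulmx1 exy' yy => <-.
have [e|e] := spin_kernel (spinP _) k1.
  have e1 : (x * y^-1)%g = 1%g by apply: val_inj.
  by rewrite -[x](mulgKV y) e1 mul1g.
have exN : spin_val x = - spin_val y.
  by rewrite -[x](mulgKV y) spin_valM e mulN1r.
have : spin_rep y = - spin_rep y by rewrite -[LHS]exy exN -scaleN1r spin_repZ
  scaleN1r.
move=> /eqP; rewrite -addr_eq0 -mulr2n -scaler_nat scaler_eq0 pnatr_eq0 /= =>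
  /eqP y0.
have := spin_rep_orth sy; rewrite y0 mulmx0 => /matrixP/(_ 0 0)/eqP.
by rewrite !mxE eq_sym oner_eq0.
Qed.

Lemma spin_rep_mulg x y :
  spin_rep (spin_val (x * y)%g) = spin_rep x *m spin_rep y.
Proof. by rewrite spin_valM spin_repM //; exact: spinP. Qed.

Lemma mxtrace_spin_rep_conj x z : \tr (spin_rep (x ^ z)%g) = \tr (spin_rep x).
Proof.
rewrite conjgE (spin_rep_mulg z^-1%g) (spin_rep_mulg x) mxtrace_mulC -mulmxA.
by rewrite -(spin_rep_mulg z) mulgV -(spin_rep_mulg x) mulg1.
Qed.

Lemma mxtrace_spin_pi_conj x z :
  \tr (spin_pi (x ^ z)%g : 'M[R]_7) = \tr (spin_pi x : 'M[R]_7).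
Proof.
rewrite conjgE (spin_pi_mxM z^-1%g) (spin_pi_mxM x) mxtrace_mulC -mulmxA
  -spin_pi_mxM.
by rewrite mulgV -spin_pi_mxM mulg1.
Qed.

Lemma stable_line_vector r (v : 'cV[R]_7) : v != 0 ->
  (forall g, exists c, spin_pi (r g) *m v = c *: v) -> has_stable_line r.
Proof.
move=> v0 hv; exists <[v]>%VS; first by rewrite dim_vline v0.
move=> g u /vlineP[a ->]; have [c ec] := hv g.
by rewrite /E_act -scalemxAr ec scalerA memvZ // memv_line.
Qed.

Lemma spin_pi1 : spin_pi (1%g : spin R 7) = 1%:M :> 'M[R]_7.
Proof. by have := @spin_mx_prod R 7 [::] isT; rewrite big_nil. Qed.

(** The actions on E have the same character, so an isometry conjugates them;
    up to sign it has determinant 1, as 7 is odd, and it lifts to the spin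
    group. *)
Lemma conj_same_pi r r' : (forall g, Defs.conjugate (r g) (r' g)) ->
  exists u : spin R 7, forall g,
    spin_pi (r' g ^ u)%g = spin_pi (r g) :> 'M[R]_7.
Proof.
move=> rr'; pose rho g : 'M[R]_7 := spin_pi (r g).
pose rho' g : 'M[R]_7 := spin_pi (r' g).
have p1 : orth_proj (1%:M : 'M[R]_7) by split; rewrite ?trmx1 ?mulmx1.
have c1 (s : Gamma -> 'M[R]_7) : intertwines s s 1%:M by move=> g;
  rewrite mulmx1 mul1mx.
have trE g : \tr (rho g *m 1%:M) = \tr (rho' g *m 1%:M).
  by have [z ez] := rr' g; rewrite !mulmx1 /rho' ez mxtrace_spin_pi_conj.
have [U [hU UtU UUt]] := exists_isometry (spin_pi_orth_rep r) (spin_pi_orth_rep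
  r')
  p1 p1 (c1 _) (c1 _) trE.
have [V [hV VtV detV]] : exists V : 'M[R]_7,
    [/\ intertwines rho rho' V, V^T *m V = 1%:M & \det V = 1].
  have : \det U * \det U = 1 by rewrite -{1}det_tr -det_mulmx UtU det1.
  move=> /eqP; rewrite -expr2 sqrf_eq1 => /orP[/eqP d|/eqP d];
    first by exists U.
  exists (- U); split.
  - by rewrite -scaleN1r; apply: intertwinesZ.
  - have -> : (- U)^T = - U^T by rewrite linearN.
    by rewrite mulNmx mulmxN opprK.
  by rewrite -scaleN1r detZ d -signr_odd /= expr1 mulrNN mulr1.
have VSO : (V^T *m V == 1%:M) && (\det V == 1) by rewrite VtV detV !eqxx.
have [u eu] := SO_lift (MkSO VSO); exists u => g.
have eV : spin_pi u = V :> 'M[R]_7 by rewrite eu.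
have VVt : V *m V^T = 1%:M := mulmx1C VtV.
have eVi : spin_pi (u^-1)%g = V^T :> 'M[R]_7.
  have : spin_pi (u^-1)%g *m spin_pi u = 1%:M :> 'M[R]_7.
    by rewrite -spin_pi_mxM mulVg spin_pi1.
  by rewrite eV => /(congr1 (mulmx^~ V^T));
    rewrite /= -mulmxA VVt mulmx1 mul1mx.
rewrite conjgE (spin_pi_mxM u^-1%g) (spin_pi_mxM (r' g)) eV eVi -[X in V^T *m
  X]/(rho' g *m V) hV mulmxA VtV.
by rewrite mul1mx.
Qed.

(** After the conjugation of [conj_same_pi], r' becomes chi r.  Without a
    stable line, [twisted_product] gives a product h of unit vectors with r h
    = chi h r, so r' is conjugate to r. *)
Lemma unacceptable_has_stable_line r : unacceptable r -> has_stable_line r.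
Proof.
move=> [r' [rr' nconj]]; apply: contrapT => nline.
have no_line (v : 'cV[R]_7) : v != 0 ->
    ~ (forall g, exists c, spin_pi (r g) *m v = c *: v).
  by move=> v0 hv; apply: nline; exact: stable_line_vector hv.
have [u hu] := conj_same_pi rr'.
pose r2 g := (r' g ^ u)%g.
have r2M g h : r2 (g * h)%g = (r2 g * r2 h)%g by rewrite /r2 gmulfM conjMg.
have r2pm g : spin_val (r2 g) = spin_val (r g) \/ spin_val (r2 g) = - spin_val
  (r g).
  have k1 : spin_mx (r2 g * (r g)^-1)%g = 1%:M.
    have := spin_pi_mxM (r2 g * (r g)^-1)%g (r g); rewrite mulgKV hu => e.
    have := congr1 (mulmx^~ (spin_pi (r g) : 'M[R]_7)^T) e.
    by rewrite /= -mulmxA (so_mul_tr (spin_pi (r g))) mulmx1 => <-.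
  have e : spin_val (r2 g) = spin_val (r2 g * (r g)^-1)%g * spin_val (r g).
    by rewrite -spin_valM mulgKV.
  by have [e1|e1] := spin_kernel (spinP _) k1; [left|right];
    rewrite e e1 ?mul1r ?mulN1r.
pose chi g : R := if spin_val (r2 g) == spin_val (r g) then 1 else -1.
have r2E g : spin_val (r2 g) = chi g *: spin_val (r g).
  rewrite /chi; case: eqP => [->|ne]; first by rewrite scale1r.
  by rewrite scaleN1r; case: (r2pm g).
have srE g : spin_rep (r2 g) = chi g *: spin_rep (r g) by rewrite r2E spin_repZ.
have chi2 g : chi g * chi g = 1 by rewrite /chi; case: eqP;
  rewrite ?mulr1 ?mulrNN ?mulr1.
have hchi : orth_rep (fun g => chi g *: spin_rep (r g)).
  split=> [g h|g]; rewrite -!srE; last by apply: spin_rep_orth; exact: spinP.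
  by rewrite r2M spin_repM //; exact: spinP.
have chi_tr g : chi g * \tr (spin_rep (r g)) = \tr (spin_rep (r g)).
  rewrite -mxtraceZ -srE /r2 mxtrace_spin_rep_conj.
  by have [z ->] := rr' g; rewrite mxtrace_spin_rep_conj.
have [chi1|chiN1] := pselect (forall g, chi g = 1).
  apply: nconj; exists u^-1%g => g.
  have <- : r2 g = r g by apply: val_inj; have := r2E g; rewrite chi1 scale1r.
  by rewrite /r2 -conjgM mulgV conjg1.
have [l [el lu hl]] : exists l : seq 'cV[R]_7,
  [/\ ~~ odd (size l), all [pred u | dotv u u == 1] l
    & forall g, spin_rep (r g) *m \prod_(u <- l) octL u =
                chi g *: (\prod_(u <- l) octL u *m spin_rep (r g))].
  apply: (twisted_product (spin_rep_orth_rep r) (spin_pi_orth_rep r)) => //.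
  - by move=> g v; apply: spin_rep_octL; exact: spinP.
  - apply: contrapT => h; apply: chiN1 => g; apply/eqP/negPn/negP => cg.
    by apply: h; exists g.
have sh : is_spin (\prod_(u <- l) cvec u) by exists l; rewrite ?el.
pose h := MkSpin (asboolT sh).
have [e _] := pin_rep_prod l; rewrite (negPf el) => eh.
have {}eh : spin_rep h = e *: \prod_(u <- l) octL u.
  by rewrite /spin_rep eh block_mxKul.
have comm g : (r g * h = h * r2 g)%g.
  apply: spin_rep_val_inj.
  rewrite (spin_rep_mulg (r g) h) (spin_rep_mulg h (r2 g)) srE eh -scalemxAr hl
    -scalemxAl -scalemxAr.
  by rewrite !scalerA mulrC.
apply: nconj; exists (h * u^-1)%g => g.
by rewrite conjgM (conjgE _ h) comm mulKg /r2 -conjgM mulgV conjg1.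
Qed.

Lemma has_stable_lineP r : has_stable_line r <->
  exists2 H : set (spin R 7), is_Spin16_subgroup H & (range r `<=` H)%classic.
Proof.
split=> [[L dL hL]|[H [L dL ->] rH]].
  exists (@spin_pi R 7 @^-1` SO_stabilizer L)%classic; first by exists L.
  move=> _ [g _ <-]; rewrite /preimage /SO_stabilizer /=.
  set f := linfun _; have fE v : f v = spin_pi (r g) *m v by rewrite lfunE.
  apply/eqP; rewrite eqEdim; apply/andP; split.
    by apply/subvP => _ /memv_imgP[v vL ->]; rewrite fE; exact: hL.
  rewrite limg_dim_eq //; apply/eqP; rewrite -subv0; apply/subvP => v.
  rewrite memv_cap memv_ker fE memv0 => /andP[_ /eqP e].
  by rewrite -[v]mul1mx -(so_tr_mul (spin_pi (r g))) -mulmxA e mulmx0.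
exists L => // g v vL; have : (r g) \in range r.
  by rewrite inE; exists g.
rewrite inE => /rH /=; rewrite /preimage /SO_stabilizer /= => eL.
rewrite -eL; have -> : E_act r g v = linfun (mulmx (spin_pi (r g) : 'M[R]_7)) v.
  by rewrite lfunE.
exact: memv_img.
Qed.

End Unacceptable.

Local Open Scope classical_set_scope.

Theorem theorem1p3 (R : realType) (Gamma : groupType)
    (r : {multiplicative Gamma -> spin R 7}) :
  (unacceptable r ->
     exists2 H : set (spin R 7), is_Spin16_subgroup H & range r `<=` H) /\
  ((exists2 H : set (spin R 7), is_Spin16_subgroup H & range r `<=` H) <->
     has_stable_line r).
Proof.
split; last by apply: iff_sym; exact: has_stable_lineP.
by move=> /unacceptable_has_stable_line/has_stable_lineP.
Qed.
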